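(* Let $n\ge 4$ and $2\le k\le n-2$, and let $v,w\in\mathfrak{S}_n$ satisfy $w=v(s_ks_{k+1}\cdots s_{n-1})(s_1s_2\cdots s_{k-1})$ and $\ell(w)-\ell(v)=n-1$ (in this situation $w(k)=1$ or $w(n)=1$). Let $1\le i<j\le n$ be such that $\ell(wt_{i,j})=\ell(w)-1$ (equivalently, $w(i)>w(j)$ and $w(p)\notin[w(j),w(i)]$ for every $i<p<j$). Then $wt_{i,j}$ is a coatom of $[v,w]$ if and only if one of the following holds: (1) $1\le i<j\le k$ or $k<i<j\le n$, and $w(i)<w(p)$ for every $i<p<j$; (2) $i=k<j\le n$, and $w(i)<w(p)$ for every $i<p<j$, and $w(n)=1$; (3) $1\le i<k<j\le n$, and $w(i)<w(p)$ for every $i<p<j$ with $p\ne k$, and $w(k)<w(j)$. Moreover, when $w(n)=1$ (respectively, $w(k)=1$), $Q_{v,w}$ is combinatorially equivalent to a cube if and only if there is no (respectively, only one) pair $(i,j)$ with $\ell(wt_{i,j})=\ell(w)-1$ satisfying (3).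
   Context: $\mathfrak{S}_n$ is the symmetric group on $\{1,\dots,n\}$ with product given by composition $(uz)(k)=u(z(k))$, $t_{i,j}=(i,j)$ is the transposition swapping $i$ and $j$, $s_i=t_{i,i+1}$ are the simple transpositions, $\ell(\cdot)$ is the length with respect to them, and $\le$ is Bruhat order. For $v\le w$, $[v,w]=\{z\in\mathfrak{S}_n\mid v\le z\le w\}$; a coatom of $[v,w]$ is an element of $[v,w]$ covered by $w$. The Bruhat interval polytope $Q_{v,w}$ is the convex hull in $\mathbb{R}^n$ of the points $(z(1),\dots,z(n))$ for $z\in[v,w]$. Two polytopes are combinatorially equivalent if their face posets are isomorphic. *)

(* Defs.v *)
From mathcomp Require Import all_boot all_order all_algebra all_fingroup.
From mathcomp Require Import boolp classical_sets functions reals convex.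

Set Implicit Arguments.
Unset Strict Implicit.
Unset Printing Implicit Defensive.

Import Order.TTheory GRing.Theory Num.Theory.

Reserved Notation "u \oS z" (at level 40, left associativity).

(* The symmetric group on {1, ..., n} is 'S_n, where the element i : 'I_n
   stands for the integer i.+1. *)

Section Permutations.
Variable n : nat.
Implicit Types u v w x z : 'S_n.

(* (u \oS z)(k) = u(z(k)); the product of MathComp goes the other way round. *)
Definition permcomp u z : 'S_n := (z * u)%g.
Local Notation "u \oS z" := (permcomp u z).

Lemma permcompE u z i : (u \oS z) i = u (z i).
Proof. by rewrite permM. Qed.

(* The integer w(p), for 1 <= p <= n (and 0 for p > n). *)
Definition oneline w (p : nat) : nat :=
  oapp (fun i : 'I_n => (w i).+1) 0 (insub p.-1).

Lemma onelineE w (i : 'I_n) : oneline w i.+1 = (w i).+1.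
Proof. by rewrite /oneline /= valK. Qed.

(* t_{i,j}, for 1 <= i, j <= n. *)
Definition transp (i j : nat) : 'S_n :=
  if insub i.-1 is Some a then
    if insub j.-1 is Some b then tperm a b else 1%g
  else 1%g.

Lemma transpE (a b : 'I_n) : transp a.+1 b.+1 = tperm a b.
Proof. by rewrite /transp /= !valK. Qed.

(* s_i, for 1 <= i < n. *)
Definition stransp (i : nat) : 'S_n := transp i i.+1.

(* s_a s_{a+1} ... s_{b-1}. *)
Definition stransp_run (a b : nat) : 'S_n :=
  \big[permcomp/1%g]_(a <= i < b) stransp i.

(* The letters are 0-based: m : 'I_n.-1 stands for s_{m+1}. *)
Definition word_prod (e : seq 'I_n.-1) : 'S_n :=
  \big[permcomp/1%g]_(m <- e) stransp m.+1.

Lemma word_prod_cat e1 e2 :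
  word_prod (e1 ++ e2) = word_prod e1 \oS word_prod e2.
Proof.
rewrite /word_prod; elim: e1 => [|m e1 IH] /=.
  by rewrite big_nil /permcomp mulg1.
by rewrite !big_cons IH /permcomp mulgA.
Qed.

Lemma word_prod_tperm (d : nat) (a b : 'I_n) :
  b = a + d :> nat -> exists e, word_prod e = tperm a b.
Proof.
elim: d b => [|d IH] b.
  rewrite addn0 => /val_inj ->; exists [::].
  by rewrite /word_prod big_nil tperm1.
rewrite addnS => Hb.
have Hc : a + d < n by apply: ltn_trans (ltn_ord b); rewrite Hb.
have Hm : a + d < n.-1 by rewrite -ltnS prednK -?Hb // (leq_ltn_trans _ Hc).
pose c := Ordinal Hc; have [e He] := IH c erefl.
pose m := Ordinal Hm.
have Hs : word_prod [:: m] = tperm c b.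
  rewrite /word_prod unlock /= /permcomp mul1g /stransp.
  have -> : (a + d).+2 = b.+1 by rewrite Hb.
  exact: (transpE c b).
have [->|nac] := eqVneq a c; first by exists [:: m].
have nab : a != b by rewrite -val_eqE /= Hb neq_ltn ltnS leq_addr.
exists ([:: m] ++ e ++ [:: m]).
rewrite !word_prod_cat He Hs /permcomp -[X in (X * _ * _)%g]tpermV -mulgA -/(conjg _ _).
rewrite tpermJ tpermL tpermD // eq_sym //.
Qed.

Lemma word_prod_surj w : exists e, word_prod e = w.
Proof.
have [ts -> _] := prod_tpermP w; elim: ts => [|[a b] ts [e He]].
  by exists [::]; rewrite /word_prod !big_nil.
rewrite big_cons /=.
have [e' He'] : exists e', word_prod e' = tperm a b.
  have [le_ab|/ltnW le_ba] := leqP a b.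
    by apply: (@word_prod_tperm (b - a)); rewrite subnKC.
  by rewrite tpermC; apply: (@word_prod_tperm (a - b)); rewrite subnKC.
by exists (e ++ e'); rewrite word_prod_cat He He'.
Qed.

Lemma len_subproof w :
  exists l, [exists e : l.-tuple 'I_n.-1, word_prod e == w].
Proof.
have [e He] := word_prod_surj w.
by exists (size e); apply/existsP; exists (in_tuple e); rewrite /= He.
Qed.

(* The least number of factors in an expression of w as a product of simple
   transpositions. *)
Definition len w : nat := ex_minn (len_subproof w).

(* Bruhat order: the reflexive transitive closure of u -> u t, for t a
   transposition with len u < len (u t). *)
Definition bruhat_step : rel 'S_n := fun u z =>
  [exists a, exists b, z == u \oS tperm a b] && (len u < len z).

Definition bruhat : rel 'S_n := connect bruhat_step.

Definition bruhat_itv v w : {set 'S_n} := [set z | bruhat v z && bruhat z w].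

Definition bruhat_cover x w : bool :=
  [&& bruhat x w, x != w &
      [forall z, bruhat x z && bruhat z w ==> (z == x) || (z == w)]].

Definition coatom v w x : bool := (x \in bruhat_itv v w) && bruhat_cover x w.

End Permutations.

Notation "u \oS z" := (permcomp u z).
Arguments transp : clear implicits.
Arguments stransp : clear implicits.
Arguments stransp_run : clear implicits.

Section CoatomTypes.
Variables (n k : nat) (w : 'S_n) (i j : nat).

Definition coatom_type1 : Prop :=
  (1 <= i /\ i < j /\ j <= k \/ k < i /\ i < j /\ j <= n) /\
  (forall p, i < p < j -> oneline w i < oneline w p).

Definition coatom_type2 : Prop :=
  (i = k /\ k < j /\ j <= n) /\
  (forall p, i < p < j -> oneline w i < oneline w p) /\
  oneline w n = 1.

Definition coatom_type3 : Prop :=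
  (1 <= i /\ i < k /\ k < j /\ j <= n) /\
  (forall p, i < p < j -> p <> k -> oneline w i < oneline w p) /\
  oneline w k < oneline w j.

End CoatomTypes.

Local Open Scope classical_set_scope.
Local Open Scope ring_scope.

Section Polytopes.
Variable R : realType.

Definition conv_hull n (A : set 'rV[R]_n) : set 'rV[R]_n :=
  smallest (@convex_set R 'rV[R]_n) A.

(* The intersections of P with the hyperplanes a.x = b such that a.x <= b holds
   on P; a = 0 gives P itself (b = 0) and the empty face (b = 1). *)
Definition faces n (P : set 'rV[R]_n) : set (set 'rV[R]_n) :=
  [set F | exists (a : 'rV[R]_n) (b : R),
    (forall x, P x -> \sum_i a 0 i * x 0 i <= b) /\
    F = [set x | P x /\ \sum_i a 0 i * x 0 i = b]].

Definition comb_equiv m n (P : set 'rV[R]_m) (Q : set 'rV[R]_n) : Prop :=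
  exists f : set 'rV[R]_m -> set 'rV[R]_n,
    set_bij (faces P) (faces Q) f /\
    (forall F G, faces P F -> faces P G -> (F `<=` G <-> f F `<=` f G)).

Definition unit_cube d : set 'rV[R]_d := [set x | forall i, 0 <= x 0 i <= 1].

Definition comb_cube n (P : set 'rV[R]_n) : Prop :=
  exists d, comb_equiv P (@unit_cube d).

Definition perm_point n (z : 'S_n) : 'rV[R]_n := \row_i (z i).+1%:R.

Definition bruhat_polytope n (v w : 'S_n) : set 'rV[R]_n :=
  conv_hull [set perm_point z | z in [set` bruhat_itv v w]].

End Polytopes.

Arguments bruhat_polytope R [n] v w _.

(* Main.v *)
(* Put W = one-line word of w, V that of v.  Then V = x L c a U and
   W = L a x U c with x = w(k), c = w(n), and additivity of the lengths says
   that x lies below a and L, and c below a and U.  By the rank criterion for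
   the Bruhat order, the prefixes of V and W differ by one exchange of entries,
   which gives the coatoms.

   For the polytope: if the largest entry N lies in L or in U, then deleting it
   from the elements of [v,w] yields the interval for the smaller words, and N
   can be reinserted in exactly two adjacent places.  This preserves the
   property of carrying pairs of functionals (F m true, F m false), m < n - 1,
   exactly one of which vanishes at each vertex, all patterns being realised; a
   polytope with that property is combinatorially a cube.  It also doubles the
   number of elements.  So a may be taken to be the largest entry.  With b the
   last entry of x L and d the first entry of U c: if b < c, the interval is
   made of the product of the intervals [xL, Lx] and [caU, aUc] and its image
   under the exchange of the entries k-1 and k, and the functionals extend; the
   case d < x is dual by reversal of words.  Otherwise, sorting the elements by
   the place of a gives at least 5 * 2^(n-3) > 2^(n-1) vertices, whereas a
   polytope in a hyperplane of R^n that is combinatorially a cube has at most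
   2^(n-1).  Finally b < c or d < x is read off the pairs (i, j) of type (3). *)

From HB Require Import structures.
Require Import Defs.
From mathcomp Require Import all_boot all_order all_algebra all_fingroup.
From mathcomp Require Import boolp classical_sets reals convex.
From mathcomp Require Import interval_inference.
From mathcomp Require Import zify lra ring.

Set Implicit Arguments.
Unset Strict Implicit.
Unset Printing Implicit Defensive.

Import Order.TTheory GRing.Theory Num.Theory.

(** * Rank counts of words and the domination order *)

Section RankOrder.
Implicit Types (s t v w z : seq nat).

(** Words carry arbitrary letters, not only 1, ..., n: deleting the largest letter, or passing to
    one factor of a concatenation, has to stay within one class of intervals. So the combinatorics
    takes place on [seq nat] with the order [dom], which is matched with [bruhat] only near the end.

    Being a cube is expressed on vertices alone ([cubical]), because affine functionals are easily
    carried from a shorter word to a longer one, whereas faces are not. Failing to be a cube is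
    expressed by a count, because a count also survives insertion: an excess over 2^d doubles to an
    excess over 2^(d+1).

    The constant 5 is 2 + 1 + 2, in units of 2^(n-3). The largest letter a is put at one of three
    consecutive places. At either outer place, deleting a leaves a smaller pair of words, for which
    both outcomes of the dichotomy guarantee 2^(n-2) elements; at the middle place, a product of two
    cycles gives 2^(n-3). *)

Definition rank s a h := count (leq h) (take a s).

Definition dom s t := forall a h, rank s a h <= rank t a h.

Definition itv v w z := [/\ perm_eq z v, dom v z & dom z w].

Lemma rank_cat s t a h :
  rank (s ++ t) a h = rank s a h + rank t (a - size s) h.
Proof.
rewrite /rank take_cat; case: ltnP => Ha.
  by rewrite (eqnP (ltnW Ha)) take0 addn0.
by rewrite count_cat (take_oversize Ha).
Qed.

Lemma rank_cons x s a h : rank (x :: s) a.+1 h = (h <= x) + rank s a h.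
Proof. by []. Qed.

Lemma rank0 s h : rank s 0 h = 0. Proof. by rewrite /rank take0. Qed.

Lemma rank_size s a h : size s <= a -> rank s a h = count (leq h) s.
Proof. by move=> Ha; rewrite /rank take_oversize. Qed.

Lemma rank_le_count s a h : rank s a h <= count (leq h) s.
Proof. by rewrite -{2}(cat_take_drop a s) count_cat leq_addr. Qed.

Lemma rankS s a h :
  rank s a.+1 h = rank s a h + ((a < size s) && (h <= nth 0 s a)).
Proof.
case: ltnP => Ha /=; last by rewrite addn0 !rank_size //; exact: leqW.
by rewrite /rank (take_nth 0 Ha) -cats1 count_cat /= addn0.
Qed.

Lemma domxx s : dom s s. Proof. by move=> a h. Qed.

Lemma dom_trans t s u : dom s t -> dom t u -> dom s u.
Proof. by move=> H1 H2 a h; exact: leq_trans (H1 a h) (H2 a h). Qed.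

Lemma dom_cat s1 s2 t1 t2 : size s1 = size t1 ->
  dom s1 t1 -> dom s2 t2 -> dom (s1 ++ s2) (t1 ++ t2).
Proof. by move=> Hs H1 H2 a h; rewrite !rank_cat Hs leq_add. Qed.

Lemma dom_cat_inv s1 s2 t1 t2 : perm_eq s1 t1 ->
  dom (s1 ++ s2) (t1 ++ t2) -> dom s1 t1 /\ dom s2 t2.
Proof.
move=> Hp H; have Hs := perm_size Hp; split=> a h.
  have [Ha|Ha] := leqP a (size s1).
    have := H a h; rewrite !rank_cat -Hs.
    by have /eqP -> : a - size s1 == 0 by []; rewrite !rank0 !addn0.
  by rewrite !rank_size ?(seq.permP Hp) // -?Hs ltnW.
have := H (size s1 + a) h; rewrite !rank_cat -Hs addKn.
rewrite (rank_size (s := s1)) ?leq_addr // (rank_size (s := t1)) -?Hs ?leq_addr //.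
by rewrite (seq.permP Hp) leq_add2l.
Qed.

Lemma dom_cat_count s1 s2 t1 t2 : dom (s1 ++ s2) (t1 ++ t2) -> size s1 = size t1 ->
  forall h, count (leq h) s1 <= count (leq h) t1.
Proof.
move=> H Hs h; have := H (size s1) h; rewrite !rank_cat Hs subnn !rank0 !addn0.
by rewrite !rank_size // Hs.
Qed.

Lemma count_leq_perm s t : (forall h, count (leq h) s = count (leq h) t) ->
  perm_eq s t.
Proof.
move=> H; apply/allP => y _ /=.
have E r : count_mem y r + count (leq y.+1) r = count (leq y) r.
  rewrite -!sumn_count !sumnE !big_map -big_split /=; apply: eq_bigr => i _.
  by case: ltngtP.
by rewrite -(eqn_add2r (count (leq y.+1) s)) E !H E.
Qed.

Lemma dom_swap s p t q u : p <= q ->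
  dom (s ++ p :: t ++ q :: u) (s ++ q :: t ++ p :: u).
Proof.
move=> pq a h; rewrite !rank_cat leq_add2l; case: (a - size s) => // b.
rewrite !rank_cons !rank_cat; case: (b - size t) => [|e]; rewrite ?rank0 ?rank_cons; lia.
Qed.

(** A prefix of the reversed word is the complement of a prefix of the word, and the total counts
    agree, so the inequality turns around. *)
Lemma dom_rev s t : perm_eq s t -> dom s t -> dom (rev t) (rev s).
Proof.
move=> Hp H a h; have Hs := perm_size Hp.
have E r : rank (rev r) a h = count (leq h) r - rank r (size r - a) h.
  rewrite /rank take_rev count_rev -[in X in _ = X - _](cat_take_drop (size r - a) r).
  by rewrite count_cat addKn.
by rewrite !E (seq.permP Hp) -Hs leq_sub2l.
Qed.

Lemma itv_rev v w z : perm_eq v w -> itv v w z -> itv (rev w) (rev v) (rev z).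
Proof.
move=> Hvw [Hp H1 H2]; have Hzw := perm_trans Hp Hvw; split.
- by rewrite perm_rev perm_sym perm_rev perm_sym.
- exact: dom_rev.
- by apply: dom_rev => //; rewrite perm_sym.
Qed.

Lemma rank_ins s1 N s2 a h : rank (s1 ++ N :: s2) a h =
  rank (s1 ++ s2) (if a <= size s1 then a else a.-1) h
    + ((size s1 < a) && (h <= N)).
Proof.
rewrite !rank_cat; case: leqP => Ha.
  by rewrite (eqnP Ha) !rank0 !addn0.
case: a Ha => // a; rewrite ltnS => Ha.
rewrite subSn //= rank_cons !(rank_size _ (s := s1)) ?(leqW Ha) //=; lia.
Qed.

Lemma dom_ins s1 s2 t1 t2 N : size s1 = size t1 ->
  dom (s1 ++ N :: s2) (t1 ++ N :: t2) <-> dom (s1 ++ s2) (t1 ++ t2).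
Proof.
move=> Hs; split=> H a h.
  have := H (if a <= size s1 then a else a.+1) h; rewrite !rank_ins -Hs.
  case: (leqP a (size s1)) => Ha; first by rewrite Ha leq_add2r.
  have -> : (a < size s1) = false by lia.
  by rewrite ltnS (ltnW Ha) leq_add2r.
by rewrite !rank_ins -Hs leq_add2r.
Qed.

(** The delicate cut is [(size t1).+1], where the right side has already counted [N] and the left
    side has not. There [N] counts for at least as much as the letter of the right word that it
    displaces. *)
Lemma dom_ins_shift s1 s2 t1 t2 N : size s1 = (size t1).+1 ->
  all (leq^~ N) (t1 ++ t2) ->
  dom (s1 ++ N :: s2) (t1 ++ N :: t2) <-> dom (s1 ++ s2) (t1 ++ t2).
Proof.
move=> Hs HN; split=> H a h.
  have [Ha|Ha] := leqP a (size t1).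
    have := H a h; rewrite !rank_ins Hs Ha leqW //.
    have -> : (size t1 < a) = false by lia.
    have -> : ((size t1).+1 < a) = false by lia.
    rewrite /= !addn0; exact: id.
  have := H a.+1 h; rewrite !rank_ins Hs !ltnS.
  have -> : (a <= size t1) = false by lia.
  have -> : (a < size t1) = false by lia.
  by rewrite Ha (ltnW Ha) leq_add2r.
rewrite !rank_ins Hs; case: (ltngtP a (size t1).+1) => Ha.
- have -> : a <= size t1 by lia.
  by rewrite /= !addn0; apply: H.
- have -> : (a <= size t1) = false by lia.
  by rewrite leq_add2r; apply: H.
have -> : (a <= size t1) = false by lia.
rewrite Ha /= addn0; apply: (leq_trans (H _ _)).
rewrite rankS leq_add2l; case: ltnP => //= Hl.
case: (leqP h) => // Hh; rewrite lt0b; apply: leq_trans Hh _.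
by apply: (allP HN); apply: mem_nth.
Qed.

Lemma rank_swap s p q u a h : a != (size s).+1 ->
  rank (s ++ q :: p :: u) a h = rank (s ++ p :: q :: u) a h.
Proof.
move=> Ha; rewrite !rank_cat; congr addn.
case E: (a - size s) => [|[|e]]; rewrite ?rank0 // ?rank_cons; last by rewrite addnCA.
by move: Ha E; lia.
Qed.

Lemma rank_prefix s u h : rank (s ++ u) (size s) h = count (leq h) s.
Proof. by rewrite rank_cat subnn rank0 addn0 rank_size. Qed.

Lemma rank_prefix1 s p u h :
  rank (s ++ p :: u) (size s).+1 h = count (leq h) s + (h <= p).
Proof. by rewrite -cat_rcons -(size_rcons s p) rank_prefix -cats1 count_cat /= addn0. Qed.

Lemma rank_prefix2 s p q u h :
  rank (s ++ p :: q :: u) (size s).+2 h = count (leq h) s + (h <= p) + (h <= q).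
Proof.
by rewrite -cat_rcons -(size_rcons s p) rank_prefix1 -cats1 count_cat /= addn0.
Qed.

(** For an ascending pair, the rank at the cut between its two letters is the average, rounded down,
    of the ranks at the two neighbouring cuts. So the inequality there follows from the neighbouring
    ones. For a descending pair the average is rounded up, which gives [dom_desc]. *)
Lemma dom_asc s p q u t p' q' u' : p <= q -> p' <= q' -> size s = size t ->
  dom (s ++ p :: q :: u) (t ++ q' :: p' :: u') ->
  dom (s ++ p :: q :: u) (t ++ p' :: q' :: u').
Proof.
move=> pq pq' Hs H a h; have [->|Ha] := eqVneq a (size t).+1; last first.
  by rewrite -(rank_swap _ _ _ _ Ha); apply: H.
have := H (size t) h; have := H (size t).+2 h.
rewrite -{1 3 5}Hs !rank_prefix !rank_prefix1 !rank_prefix2; lia.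
Qed.

Lemma dom_desc s p q u t p' q' u' : p <= q -> p' <= q' -> size s = size t ->
  dom (s ++ p :: q :: u) (t ++ q' :: p' :: u') ->
  dom (s ++ q :: p :: u) (t ++ q' :: p' :: u').
Proof.
move=> pq pq' Hs H a h; have [->|Ha] := eqVneq a (size s).+1; last first.
  by rewrite (rank_swap _ _ _ _ Ha); apply: H.
have := H (size s) h; have := H (size s).+2 h.
rewrite {2 4 6}Hs !rank_prefix !rank_prefix1 !rank_prefix2; lia.
Qed.

End RankOrder.

(** * Intervals under insertion, concatenation and exchange *)

Section Intervals.
Implicit Types (s t v w z : seq nat).

Lemma mem_split (y : nat) s : y \in s -> exists s1 s2, s = s1 ++ y :: s2.
Proof. by case/splitPr => s1 s2; exists s1, s2. Qed.

Lemma perm_ins s1 s2 t1 t2 (N : nat) :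
  perm_eq (s1 ++ N :: s2) (t1 ++ N :: t2) = perm_eq (s1 ++ s2) (t1 ++ t2).
Proof.
rewrite (permPl (permEl (perm_catCA s1 [:: N] s2))).
by rewrite (permPr (permEl (perm_catCA t1 [:: N] t2))) /= perm_cons.
Qed.

Lemma rank_top s1 s2 N a : all (ltn^~ N) (s1 ++ s2) ->
  rank (s1 ++ N :: s2) a N = (size s1 < a).
Proof.
move=> H; rewrite rank_ins leqnn andbT.
suff /eqP -> : rank (s1 ++ s2) (if a <= size s1 then a else a.-1) N == 0 by [].
rewrite -leqn0; apply: leq_trans (rank_le_count _ _ _) _.
rewrite leqn0 -leqn0 leqNgt -has_count -all_predC.
by apply: sub_all H => y /=; rewrite -ltnNge.
Qed.

Lemma itv_ins v1 v2 w1 w2 z1 z2 N :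
  size v1 = (size w1).+1 -> all (ltn^~ N) (v1 ++ v2) ->
  perm_eq (v1 ++ v2) (w1 ++ w2) ->
  size z1 = size v1 \/ size z1 = size w1 ->
  itv (v1 ++ v2) (w1 ++ w2) (z1 ++ z2) ->
  itv (v1 ++ N :: v2) (w1 ++ N :: w2) (z1 ++ N :: z2).
Proof.
move=> Hs HN Hvw Hz [Hp H1 H2].
have HNle s : perm_eq (v1 ++ v2) s -> all (leq^~ N) s.
  by move=> Hps; rewrite -(perm_all _ Hps); apply: sub_all HN => y; apply: ltnW.
split; first by rewrite perm_ins.
  case: Hz => Hz; first exact/dom_ins.
  by apply/dom_ins_shift => //; [rewrite Hz | apply: HNle; rewrite perm_sym].
case: Hz => Hz; last exact/dom_ins.
by apply/dom_ins_shift => //; [rewrite Hz | apply: HNle].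
Qed.

(** At threshold [N] only the letter [N] is counted, so the ranks squeeze its place in [z] between
    its places in the two ends, which are adjacent. *)
Lemma itv_ins_inv v1 v2 w1 w2 z N :
  size v1 = (size w1).+1 -> all (ltn^~ N) (v1 ++ v2) ->
  perm_eq (v1 ++ v2) (w1 ++ w2) ->
  itv (v1 ++ N :: v2) (w1 ++ N :: w2) z ->
  exists z1 z2, [/\ z = z1 ++ N :: z2,
    size z1 = size v1 \/ size z1 = size w1 &
    itv (v1 ++ v2) (w1 ++ w2) (z1 ++ z2)].
Proof.
move=> Hs HN Hvw [Hp H1 H2].
have zN : N \in z by rewrite (perm_mem Hp) mem_cat mem_head orbT.
have [z1 [z2 Ez]] := mem_split zN; subst z; rewrite perm_ins in Hp.
have HNz : all (ltn^~ N) (z1 ++ z2) by rewrite (perm_all _ Hp).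
have HNw : all (ltn^~ N) (w1 ++ w2) by rewrite -(perm_all _ Hvw).
have HNle s : all (ltn^~ N) s -> all (leq^~ N) s.
  by apply: sub_all => y; apply: ltnW.
have Hz : size z1 = size v1 \/ size z1 = size w1.
  have := H1 (size v1).+1 N; have := H2 (size z1).+1 N.
  by rewrite !rank_top //; lia.
exists z1, z2; split=> //; split=> //; case: Hz => Hz.
- exact/(dom_ins _ _ N).
- by apply/(dom_ins_shift _ (N := N)) => //; [rewrite Hz | apply: HNle].
- by apply/(dom_ins_shift _ (N := N)) => //; [rewrite Hz | apply: HNle].
- exact/(dom_ins _ _ N).
Qed.

Lemma itv_cat v1 v2 w1 w2 z1 z2 : size z1 = size w1 ->
  itv v1 w1 z1 -> itv v2 w2 z2 -> itv (v1 ++ v2) (w1 ++ w2) (z1 ++ z2).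
Proof.
move=> Hs [Hp1 H11 H12] [Hp2 H21 H22]; split; first exact: perm_cat.
  by apply: dom_cat => //; rewrite (perm_size Hp1).
exact: dom_cat.
Qed.

(** The first blocks of the two ends have the same letters, so the counts of the corresponding
    prefix of [z] lie between equal numbers, and its letters are the same too. *)
Lemma itv_cat_inv v1 v2 w1 w2 z : perm_eq v1 w1 ->
  itv (v1 ++ v2) (w1 ++ w2) z ->
  exists z1 z2, [/\ z = z1 ++ z2, itv v1 w1 z1 & itv v2 w2 z2].
Proof.
move=> Hvw [Hp H1 H2]; have Hs := perm_size Hvw.
have Hz : size (take (size v1) z) = size v1.
  by rewrite size_takel // (perm_size Hp) size_cat leq_addr.
move: (take _ z) (drop (size v1) z) Hz (cat_take_drop (size v1) z) => z1 z2 Hz Ez.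
rewrite -Ez in Hp H1 H2 *.
have Hp1 : perm_eq z1 v1.
  apply: count_leq_perm => h; apply/eqP; rewrite eqn_leq.
  rewrite (dom_cat_count H1) // (seq.permP Hvw) andbT.
  by apply: (dom_cat_count H2); rewrite Hz.
have Hp1' : perm_eq v1 z1 by rewrite perm_sym.
have [d1 d2] := dom_cat_inv Hp1' H1.
have [d3 d4] := dom_cat_inv (perm_trans Hp1 Hvw) H2.
exists z1, z2; split=> //; split=> //.
by rewrite -(perm_cat2l v1); apply: perm_trans Hp; rewrite perm_cat2r.
Qed.

(* The lifting property of the Bruhat order, at an ascent of v that is a descent
   of w. *)
Lemma itv_exchange M b c V L a x U A p q B :
  b <= c -> x <= a -> p <= q -> size A = size M -> size M = size L ->
  itv (M ++ b :: c :: V) (L ++ x :: a :: U) (A ++ p :: q :: B) ->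
  itv (M ++ b :: c :: V) (L ++ a :: x :: U) (A ++ p :: q :: B) /\
  itv (M ++ b :: c :: V) (L ++ a :: x :: U) (A ++ q :: p :: B).
Proof.
move=> bc xa pq HA HM [Hp H1 H2].
have Hw : dom (A ++ p :: q :: B) (L ++ a :: x :: U).
  by apply: dom_trans H2 _; apply: (@dom_swap _ _ [::]).
split; split=> //.
- by apply: perm_trans Hp; rewrite perm_cat2l (perm_catCA [:: q] [:: p] B).
- by apply: dom_trans H1 _; apply: (@dom_swap _ _ [::]).
- by apply: dom_desc => //; rewrite HA.
Qed.

(** Sorting the two letters of [z] at the exchanged places gives a word that stays above the lower
    end and falls below the upper end with its descent [a], [x] undone. *)
Lemma itv_exchange_inv M b c V L a x U z :
  b <= c -> x <= a -> size M = size L ->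
  itv (M ++ b :: c :: V) (L ++ a :: x :: U) z ->
  exists A p q B, [/\ p <= q, size A = size M,
    itv (M ++ b :: c :: V) (L ++ x :: a :: U) (A ++ p :: q :: B) &
    z = A ++ p :: q :: B \/ z = A ++ q :: p :: B].
Proof.
move=> bc xa HM [Hp H1 H2].
have Hs : size z = size M + (size V).+2 by rewrite (perm_size Hp) size_cat.
have HA : size (take (size M) z) = size M by rewrite size_takel // Hs leq_addr.
move: (take _ z) (drop (size M) z) HA (cat_take_drop (size M) z) => A D HA Ez.
move: Hs; rewrite -Ez size_cat HA => /addnI; case: D Ez => [|p [|q B]] // Ez _.
rewrite -Ez in Hp H1 H2.
have [pq|/ltnW pq] := leqP p q.
  exists A, p, q, B; split=> //; last by left.
  by split=> //; apply: dom_asc => //; rewrite HA.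
exists A, q, p, B; split=> //; last by right.
split.
- by apply: perm_trans Hp; rewrite perm_cat2l (perm_catCA [:: q] [:: p] B).
- by apply: dom_asc => //; rewrite HA.
apply: dom_asc => //; first by rewrite HA.
by apply: dom_trans H2; apply: (@dom_swap _ _ [::]).
Qed.

Lemma max_mem s : s != [::] -> exists2 N, N \in s & all (leq^~ N) s.
Proof.
case: s => // y s _; elim: s y => [|u s IH] y; first by exists y; rewrite ?inE //= leqnn.
have [N NI HN] := IH u; have [yN|Ny] := leqP y N.
  by exists N; [rewrite inE NI orbT | rewrite /= yN].
exists y; [by rewrite inE eqxx | rewrite /= leqnn].
by apply: sub_all HN => z /= zN; apply: leq_trans zN (ltnW Ny).
Qed.

Lemma uniq_max_lt s1 s2 N : uniq (s1 ++ N :: s2) ->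
  all (leq^~ N) (s1 ++ N :: s2) -> all (ltn^~ N) (s1 ++ s2).
Proof.
rewrite (perm_uniq (permEl (perm_catCA s1 [:: N] s2))).
rewrite (perm_all _ (permEl (perm_catCA s1 [:: N] s2))) /= => /andP[HN _] /andP[_ H].
apply/allP => y Hy; rewrite /= ltn_neqAle (allP H) // andbT.
by apply: contraNneq HN => <-.
Qed.

End Intervals.

(** * Families of words with the vertex patterns of a cube *)

Section Cubical.
Variable R : realFieldType.
Implicit Types (s z : seq nat) (f g : nat -> R) (E : seq nat -> Prop).
Local Open Scope ring_scope.

Fixpoint linval f s : R :=
  if s is x :: s' then f 0%N * x%:R + linval (fun i => f i.+1) s' else 0.

Lemma linval_cat f s z :
  linval f (s ++ z) = linval f s + linval (fun i => f (size s + i)%N) z.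
Proof.
elim: s f => [|x s IH] f /=; first by rewrite add0r.
by rewrite IH addrA.
Qed.

Lemma eq_linval f g s : (forall i, (i < size s)%N -> f i = g i) ->
  linval f s = linval g s.
Proof.
elim: s f g => [|x s IH] f g //= H; rewrite (H 0%N) // (IH _ (fun i => g i.+1)) //.
by move=> i Hi; apply: H.
Qed.

Lemma linvalB f c s : linval (fun i => f i - c) s = linval f s - c * (sumn s)%:R.
Proof.
elim: s f => [|x s IH] f /=; first by rewrite mulr0 subr0.
by rewrite IH natrD; ring.
Qed.

Lemma linval0 s : linval (fun=> 0) s = 0.
Proof. by elim: s => //= x s IH; rewrite IH mul0r addr0. Qed.

Lemma linval_delta j c s :
  linval (fun i => (i == j)%:R * c) s = c * (nth 0%N s j)%:R.
Proof.
elim: s j => [|x s IH] [|j] /=; rewrite ?mulr0 //.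
  by rewrite mul1r (@eq_linval _ (fun=> 0)) ?linval0 ?addr0 // => i _; rewrite mul0r.
by rewrite !mul0r add0r -IH; apply: eq_linval.
Qed.

Definition affval (F : (nat -> R) * R) s : R := linval F.1 s + F.2.

(* F m b is meant to be nonnegative: A records, for each m < d, which of the two
   opposite facets F m true = 0 and F m false = 0 contains z. *)
Definition pattern (F : nat -> bool -> (nat -> R) * R) d z (A : nat -> bool) :=
  forall m b, (m < d)%N ->
    if A m == b then affval (F m b) z = 0 else 0 < affval (F m b) z.

Definition cubical E d := exists F : nat -> bool -> (nat -> R) * R,
  (forall z, E z -> exists A, pattern F d z A) /\
  (forall A, exists2 z, E z & pattern F d z A).

Lemma pattern_inj F d z A B : pattern F d z A -> pattern F d z B ->
  forall m, (m < d)%N -> A m = B m.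
Proof.
move=> HA HB m Hm; have := HA m (A m) Hm; have := HB m (A m) Hm.
by rewrite eqxx; case: eqP => // _ /[swap] ->; rewrite ltxx.
Qed.

Lemma eq_cubical E E' d : (forall z, E z <-> E' z) -> cubical E d -> cubical E' d.
Proof.
move=> H [F [H1 H2]]; exists F; split=> [z /H/H1 //|A].
by have [z /H Ez Pz] := H2 A; exists z.
Qed.

Lemma cubical_singl (z : seq nat) : cubical (fun y => y = z) 0.
Proof.
exists (fun _ _ => (fun=> 0, 0)); split=> [y _|A]; first by exists (fun=> true).
by exists z.
Qed.

Section Insertion.
Variables (j N : nat).

(** The places [j] and [j.+1] receive the same coefficient. Whichever of them holds [N], the other
    one holds the old letter of place [j], and the constant cancels the contribution of [N]. *)
Definition merge (F : (nat -> R) * R) : (nat -> R) * R :=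
  (fun i => F.1 (if (i <= j)%N then i else i.-1), F.2 - F.1 j * N%:R).

Lemma affval_merge F s z : size s = j \/ size s = j.+1 ->
  affval (merge F) (s ++ N :: z) = affval F (s ++ z).
Proof.
move=> Hs; rewrite /affval /merge /= !linval_cat /= addn0.
have Hs' : (size s <= j.+1)%N by case: Hs => ->.
rewrite (@eq_linval _ F.1 s); last first.
  by move=> i Hi; rewrite -ltnS (leq_trans Hi).
have -> : (if (size s <= j)%N then size s else (size s).-1) = j.
  by case: Hs => ->; rewrite ?leqnn ?ltnn.
rewrite (@eq_linval _ (fun i => F.1 (size s + i)%N) z); first by ring.
move=> i _; congr F.1; have -> : (size s + i.+1 <= j)%N = false by case: Hs; lia.
by rewrite addnS.
Qed.

Lemma cubical_ins E' E d :
  (forall z, E' z -> (j < size z)%N /\ all (ltn^~ N) z) ->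
  (forall z, E z -> exists z1 z2,
     [/\ z = z1 ++ N :: z2, size z1 = j \/ size z1 = j.+1 & E' (z1 ++ z2)]) ->
  (forall z1 z2, size z1 = j \/ size z1 = j.+1 -> E' (z1 ++ z2) ->
     E (z1 ++ N :: z2)) ->
  cubical E' d -> cubical E d.+1.
Proof.
move=> HN HE1 HE2 [F [HF1 HF2]].
(* The new pair is [N] minus the letter at [j] and [N] minus the letter at [j.+1]: both are
   nonnegative, and exactly the one at the place of [N] vanishes. *)
pose G (m : nat) (b : bool) := if m is m'.+1 then merge (F m' b)
  else (fun i : nat => (i == (if b then j else j.+1))%:R * -1, N%:R) : (nat -> R) * R.
have key z1 z2 A : size z1 = j \/ size z1 = j.+1 -> E' (z1 ++ z2) ->
    pattern F d (z1 ++ z2) A ->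
    pattern G d.+1 (z1 ++ N :: z2)
      (fun m => if m is m'.+1 then A m' else size z1 == j).
  move=> Hz /HN [Hj HNz] HA [|m] b Hm; last by rewrite /= affval_merge //; apply: HA.
  have N0 : (0 < N)%N.
    case: (z1 ++ z2) Hj HNz => // y s _ /andP[Hy _]; exact: leq_ltn_trans Hy.
  have ltN (i : nat) : i != size z1 -> (nth 0%N (z1 ++ N :: z2) i < N)%N.
    move: HNz; rewrite all_cat nth_cat => /andP[/(all_nthP 0%N) h1 /(all_nthP 0%N) h2] Hi.
    case: (ltnP i (size z1)) => Hi'; first exact: h1.
    have -> : (i - size z1 = (i - size z1).-1.+1)%N by lia.
    rewrite /=; case: (ltnP (i - size z1).-1 (size z2)) => Hi2; first exact: h2.
    by rewrite nth_default.
  rewrite /affval /= linval_delta mulN1r.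
  have E1 : nth 0%N (z1 ++ N :: z2) (size z1) = N by rewrite nth_cat ltnn subnn.
  case: Hz => Hz; rewrite Hz ?eqxx.
    case: b => /=; first by rewrite -{1}Hz E1 addNr.
    by rewrite addrC subr_gt0 ltr_nat ltN // Hz; lia.
  have -> : (j.+1 == j) = false by lia.
  case: b => /=; last by rewrite -{1}Hz E1 addNr.
  by rewrite addrC subr_gt0 ltr_nat ltN // Hz; lia.
exists G; split=> [z /HE1[z1 [z2 [-> Hz Ez]]]|A].
  by have [A HA] := HF1 _ Ez; exists (fun m => if m is m'.+1 then A m' else size z1 == j);
    apply: key.
have [z Ez Pz] := HF2 (fun m => A m.+1); have [Hj _] := HN _ Ez.
pose i := if A 0%N then j else j.+1.
have Hi : size (take i z) = i by rewrite size_takel // /i; case: ifP => _ //; exact: ltnW.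
have Hi' : size (take i z) = j \/ size (take i z) = j.+1.
  by rewrite Hi /i; case: ifP; [left|right].
exists (take i z ++ N :: drop i z); first by apply: HE2; rewrite ?cat_take_drop.
have := @key (take i z) (drop i z) (fun m => A m.+1) Hi'; rewrite cat_take_drop.
move=> /(_ Ez Pz) H [|m] b Hm; have := H _ b Hm => //.
by rewrite Hi /i; case: (A 0%N); rewrite ?eqxx // gtn_eqF.
Qed.

End Insertion.

Definition shift k (F : (nat -> R) * R) : (nat -> R) * R :=
  (fun i => if (i < k)%N then 0 else F.1 (i - k)%N, F.2).
Definition clip k (F : (nat -> R) * R) : (nat -> R) * R :=
  (fun i => if (i < k)%N then F.1 i else 0, F.2).

Lemma affval_shift F s z : affval (shift (size s) F) (s ++ z) = affval F z.
Proof.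
rewrite /affval /= linval_cat (@eq_linval _ (fun=> 0) s); last by move=> i ->.
rewrite linval0 add0r; congr (_ + _); apply: eq_linval => i _.
by rewrite ltnNge leq_addr addKn.
Qed.

Lemma affval_clip F s z : affval (clip (size s) F) (s ++ z) = affval F s.
Proof.
rewrite /affval /= linval_cat (@eq_linval _ F.1 s); last by move=> i ->.
rewrite (@eq_linval _ (fun=> 0) z) ?linval0 ?addr0 // => i _.
by rewrite ltnNge leq_addr.
Qed.

Lemma cubical_cat E1 E2 k d1 d2 : (forall z, E1 z -> size z = k) ->
  cubical E1 d1 -> cubical E2 d2 ->
  cubical (fun z => exists z1 z2, [/\ z = z1 ++ z2, E1 z1 & E2 z2]) (d1 + d2).
Proof.
move=> Hk [F1 [H11 H12]] [F2 [H21 H22]].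
pose F m b := if (m < d1)%N then clip k (F1 m b) else shift k (F2 (m - d1)%N b).
have key z1 z2 A1 A2 A : size z1 = k ->
    (forall m, (m < d1)%N -> A m = A1 m) -> (forall m, (m < d2)%N -> A (d1 + m)%N = A2 m) ->
    pattern F1 d1 z1 A1 -> pattern F2 d2 z2 A2 -> pattern F (d1 + d2) (z1 ++ z2) A.
  move=> Hz HA1 HA2 P1 P2 m b Hm; rewrite /F -Hz; case: ltnP => Hm1.
    by rewrite affval_clip HA1 //; apply: P1.
  have Em : m = (d1 + (m - d1))%N by rewrite subnKC.
  rewrite affval_shift {1}Em HA2; last by lia.
  by apply: P2; lia.
exists F; split=> [_ [z1 [z2 [-> E1z E2z]]]|A].
  have [A1 P1] := H11 _ E1z; have [A2 P2] := H21 _ E2z.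
  exists (fun m => if (m < d1)%N then A1 m else A2 (m - d1)%N).
  apply: (key _ _ A1 A2) => //; [exact: Hk | by move=> m -> |].
  by move=> m _; rewrite ltnNge leq_addr addKn.
have [z1 E1z P1] := H12 A; have [z2 E2z P2] := H22 (fun m => A (d1 + m)%N).
exists (z1 ++ z2); first by exists z1, z2.
by apply: (key _ _ A (fun m => A (d1 + m)%N)) => //; apply: Hk.
Qed.

(* The two entries at positions k and k+1 are determined on E0 by the others, so
   every functional can be rewritten so as to ignore them; the exchange then
   only affects the sum of the first k+1 entries. *)
Lemma cubical_exchange E0 E k d (sg1 sg2 : nat) :
  (forall z, E0 z -> exists A p q B, size A = k /\ z = A ++ p :: q :: B) ->
  (forall A p q B, size A = k -> E0 (A ++ p :: q :: B) ->
     [/\ (p < q)%N, (sumn A + p = sg1)%N & (q + sumn B = sg2)%N]) ->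
  (forall z, E z <-> exists A p q B, [/\ size A = k, E0 (A ++ p :: q :: B) &
     z = A ++ p :: q :: B \/ z = A ++ q :: p :: B]) ->
  cubical E0 d -> cubical E d.+1.
Proof.
move=> Hdec Hsum HE [F [HF1 HF2]].
(* On [E0], the letter at [k] is [sg1] minus the sum of the letters before it, and the letter at
   [k.+1] is [sg2] minus the sum of those after it; [elim2] substitutes these values. *)
pose elim2 (f : (nat -> R) * R) : (nat -> R) * R :=
  (fun i => if (i < k)%N then f.1 i - f.1 k
            else if (i < k.+2)%N then 0 else f.1 i - f.1 k.+1,
   f.2 + f.1 k * sg1%:R + f.1 k.+1 * sg2%:R).
(* The new pair is the sum of the first [k] letters plus the letter at [k], respectively at [k.+1],
   minus [sg1]. One of the two is 0 and the other is q - p > 0, according to whether the exchange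
   took place. *)
pose G (m : nat) (b : bool) := if m is m'.+1 then elim2 (F m' b)
  else (fun i => if (i < k)%N then 1 else (i == if b then k else k.+1)%:R, - sg1%:R).
have Eelim (f : (nat -> R) * R) A p q B : size A = k -> affval (elim2 f) (A ++ p :: q :: B) =
    linval f.1 A - f.1 k * (sumn A)%:R +
    (linval (fun i => f.1 (k.+2 + i)%N) B - f.1 k.+1 * (sumn B)%:R)
    + f.2 + f.1 k * sg1%:R + f.1 k.+1 * sg2%:R.
  move=> HA; rewrite /affval /elim2 /= linval_cat /= HA addn0 addn1 !ltnn !ltnS leqnn.
  rewrite ltnNge leqnSn /= !mul0r !add0r -!linvalB.
  rewrite (@eq_linval _ (fun i => f.1 i - f.1 k) A); last by move=> i; rewrite HA => ->.
  rewrite (@eq_linval _ (fun i => f.1 (k.+2 + i)%N - f.1 k.+1) B); first by rewrite !addrA.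
  by move=> i _; rewrite !addnS !addSn !ltnNge !leqW ?leq_addr.
have keyF (f : (nat -> R) * R) A p q B : size A = k -> E0 (A ++ p :: q :: B) ->
    affval (elim2 f) (A ++ p :: q :: B) = affval f (A ++ p :: q :: B) /\
    affval (elim2 f) (A ++ q :: p :: B) = affval f (A ++ p :: q :: B).
  move=> HA /(Hsum _ _ _ _ HA) [_ Hs1 Hs2]; rewrite !Eelim // /affval linval_cat /= HA.
  rewrite addn0 addn1 -Hs1 -Hs2 !natrD.
  rewrite (@eq_linval (fun i => f.1 (k + i.+2)%N) (fun i => f.1 (k.+2 + i)%N)).
    by split; ring.
  by move=> i _; rewrite !addnS.
have key0 b A p q B : size A = k -> affval (G 0%N b) (A ++ p :: q :: B) =
    (sumn A)%:R + (if b then p else q)%:R - sg1%:R.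
  move=> HA; rewrite /affval /G /= linval_cat /= HA addn0 addn1 ltnn ltnNge leqnSn /=.
  rewrite (@eq_linval _ (fun i => 0 - (-1)) A) ?linvalB ?linval0; last first.
    by move=> i; rewrite HA => ->; rewrite sub0r opprK.
  rewrite (@eq_linval _ (fun=> 0) B) ?linval0; last first.
    move=> i _; rewrite ltnNge leq_addr /=; case: b; case: eqP => //; lia.
  have E1 : (k == k.+1) = false by lia.
  have E2 : (k.+1 == k) = false by lia.
  by case: b; rewrite ?eqxx ?E1 ?E2 /=; ring.
have key A p q B P e : size A = k -> E0 (A ++ p :: q :: B) ->
    pattern F d (A ++ p :: q :: B) P ->
    pattern G d.+1 (A ++ (if e then p :: q :: B else q :: p :: B))
     (fun m => if m is m'.+1 then P m' else e).
  move=> HA HE0 HP [|m] b Hm.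
    have [pq Hs1 Hs2] := Hsum _ _ _ _ HA HE0.
    have pq' : p%:R < q%:R :> R by rewrite ltr_nat.
    by case: e; case: b; rewrite key0 //= -Hs1 natrD; lra.
  have [H1 H2] := keyF (F m b) _ _ _ _ HA HE0.
  by case: e; rewrite /= ?H1 ?H2; apply: HP.
exists G; split=> [z /HE[A [p [q [B [HA HE0 Hz]]]]]|P].
  have [P HP] := HF1 _ HE0.
  case: Hz => ->; [exists (fun m => if m is m'.+1 then P m' else true)
                 | exists (fun m => if m is m'.+1 then P m' else false)].
    exact: (key A p q B P true).
  exact: (key A p q B P false).
have [z HE0 HP] := HF2 (fun m => P m.+1).
have [A [p [q [B [HA Ez]]]]] := Hdec _ HE0; rewrite Ez in HE0 HP.
exists (A ++ (if P 0%N then p :: q :: B else q :: p :: B)).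
  by apply/HE; exists A, p, q, B; split=> //; case: (P 0%N); [left|right].
have H := key _ _ _ _ _ (P 0%N) HA HE0 HP.
by move=> [|m] b Hm; apply: H.
Qed.

Definition atleast E K := exists l : seq (seq nat),
  [/\ uniq l, (K <= size l)%N & forall z, z \in l -> E z].

Lemma atleast_leq E K K' : (K' <= K)%N -> atleast E K -> atleast E K'.
Proof. by move=> H [l [Hu Hs Hl]]; exists l; split=> //; apply: leq_trans Hs. Qed.

Lemma atleast_map E E' K (h : seq nat -> seq nat) :
  (forall y z, E y -> E z -> h y = h z -> y = z) -> (forall z, E z -> E' (h z)) -> atleast E K -> atleast E' K.
Proof.
move=> hI hE [l [Hu Hs Hl]]; exists (map h l); split; last first.
- by move=> _ /mapP[z /Hl Ez ->]; apply: hE.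
- by rewrite size_map.
by rewrite map_inj_in_uniq // => y z /Hl Hy /Hl Hz; apply: hI.
Qed.

Lemma atleast_or E1 E2 E K1 K2 :
  (forall z, E1 z -> E2 z -> False) ->
  (forall z, E1 z \/ E2 z -> E z) ->
  atleast E1 K1 -> atleast E2 K2 -> atleast E (K1 + K2).
Proof.
move=> H0 H [l1 [Hu1 Hs1 Hl1]] [l2 [Hu2 Hs2 Hl2]]; exists (l1 ++ l2); split.
- rewrite cat_uniq Hu1 Hu2 andbT; apply/hasPn => z /Hl2 z2.
  by apply/negP => /Hl1 z1; exact: H0 z1 z2.
- by rewrite size_cat leq_add.
by move=> z; rewrite mem_cat => /orP[/Hl1|/Hl2] Hz; apply: H; [left|right].
Qed.

Lemma cubical_atleast E d : cubical E d -> atleast E (2 ^ d).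
Proof.
move=> [F [_ HF]].
pose ext (A : {ffun 'I_d -> bool}) m := oapp A true (insub m).
have /fin_all_exists [h Hh] : forall A : {ffun 'I_d -> bool},
    exists z, E z /\ pattern F d z (ext A).
  by move=> A; have [z Ez Pz] := HF (ext A); exists z.
exists (map h (enum {ffun 'I_d -> bool})); split; last first.
- by move=> _ /mapP[A _ ->]; have [] := Hh A.
- by rewrite size_map -cardE card_ffun card_bool card_ord.
rewrite map_inj_uniq ?enum_uniq // => A B HAB; apply/ffunP => m.
have [_ P1] := Hh A; have [_] := Hh B; rewrite -HAB => P2.
have := pattern_inj P1 P2 (ltn_ord m).
by rewrite /ext valK.
Qed.

End Cubical.

(** * The two words and the dichotomy between cubes and large intervals *)

Section Cross.
Variable R : realFieldType.
Implicit Types (s z L U : seq nat).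

Definition ins i (N : nat) z := take i z ++ N :: drop i z.

Lemma nth_ins i N z : i <= size z -> nth 0 (ins i N z) i = N.
Proof. by move=> Hi; rewrite nth_cat size_takel // ltnn subnn. Qed.

Lemma ins_inj i N y z : i <= size y -> i <= size z -> ins i N y = ins i N z -> y = z.
Proof.
move=> Hy Hz /eqP; rewrite eqseq_cat ?size_takel // eqseq_cons eqxx /=.
by case/andP=> /eqP H1 /eqP H2; rewrite -(cat_take_drop i y) H1 H2 cat_take_drop.
Qed.

Lemma nth_ins_neq i j N z : j != i -> all (ltn^~ N) z -> i <= size z -> 0 < N ->
  nth 0 (ins i N z) j != N.
Proof.
move=> ji HN Hi N0; rewrite /ins nth_cat size_takel //.
have Hlt s k : all (ltn^~ N) s -> nth 0 s k < N.
  move=> /(all_nthP 0) Hs; case: (ltnP k (size s)) => Hk; first exact: Hs.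
  by rewrite nth_default.
move: HN; rewrite -{1}(cat_take_drop i z) all_cat => /andP[H1 H2].
case: (ltnP j i) => ij; first by rewrite neq_ltn Hlt.
have -> : (j - i = (j - i).-1.+1)%N by lia.
by rewrite /= neq_ltn Hlt.
Qed.

Section InsertMax.
Variables (v1 v2 w1 w2 : seq nat) (N : nat).
Hypothesis Hs : size v1 = (size w1).+1.
Hypothesis HN : all (ltn^~ N) (v1 ++ v2).
Hypothesis Hvw : perm_eq (v1 ++ v2) (w1 ++ w2).

Let E' := itv (v1 ++ v2) (w1 ++ w2).
Let E := itv (v1 ++ N :: v2) (w1 ++ N :: w2).

Let HE' z : E' z -> size w1 < size z /\ all (ltn^~ N) z.
Proof.
case=> Hp _ _; rewrite (perm_size Hp) (perm_all _ Hp) HN; split=> //.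
by rewrite size_cat Hs; lia.
Qed.

Lemma cubical_itv_ins d : cubical R E' d -> cubical R E d.+1.
Proof.
apply: (@cubical_ins _ (size w1) N) => //.
  move=> z /(itv_ins_inv Hs HN Hvw) [z1 [z2 [Ez Hz HE]]].
  by exists z1, z2; split=> //; rewrite -Hs; case: Hz => ->; [right|left].
move=> z1 z2 Hz HE; apply: itv_ins => //; rewrite Hs.
by case: Hz => ->; [right|left].
Qed.

Lemma atleast_itv_ins K : atleast E' K -> atleast E (K + K).
Proof.
move=> HK; have HI i : i = size v1 \/ i = size w1 ->
    atleast (fun z => E z /\ nth 0 z i = N /\ forall j, j != i -> nth 0 z j != N) K.
  move=> Hi; have Hi' z : E' z -> i <= size z.
    by case/HE' => Hz _; case: Hi => ->; rewrite ?Hs // ltnW.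
  apply: (atleast_map (h := ins i N) _ _ HK) => [y z /Hi' Hy /Hi' Hz|z Ez]; first exact: ins_inj.
  have Hz := Hi' _ Ez; have [Hz1 HzN] := HE' Ez; split; last split.
  - by apply: itv_ins => //; rewrite ?cat_take_drop // size_takel.
  - exact: nth_ins.
  move=> j ji; apply: nth_ins_neq => //.
  by case: (z) Hz1 HzN => // y s _ /andP[Hy _]; apply: leq_ltn_trans Hy.
apply: atleast_or (HI _ (or_introl erefl)) (HI _ (or_intror erefl)).
  move=> z [_ [H1 _]] [_ [_ /(_ (size v1))]]; rewrite H1 eqxx Hs => H.
  by have := H _; rewrite neq_ltn ltnSn orbT => /(_ isT).
by move=> z [[]|[]].
Qed.

End InsertMax.

(** Moving [x] from the front to the back shifts the largest letter of [L] by exactly one place, so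
    deleting it leaves the same situation for a shorter [L] and removes one dimension. *)
Lemma cubical_cycle x L : uniq (x :: L) -> all (ltn x) L ->
  cubical R (itv (x :: L) (rcons L x)) (size L).
Proof.
move: {2}(size L) (leqnn (size L)) => n; elim: n L => [|n IH] L.
  rewrite leqn0 => /nilP -> _ _.
  apply: eq_cubical (cubical_singl R [:: x]) => z; split=> [->|[Hp _ _]].
    by split=> //; apply: domxx.
  by apply: perm_small_eq.
move=> Hn Hu HL; case: (eqVneq L [::]) => [E|L0].
  by rewrite E in Hu HL *; apply: IH.
have [N NL HN] := max_mem L0; have [L1 [L2 EL]] := mem_split NL; subst L.
have HN2 : all (ltn^~ N) (L1 ++ L2).
  by apply: uniq_max_lt HN; case/andP: Hu.
have xN : x < N by apply: (allP HL).
rewrite rcons_cat /= size_cat addnS -size_cat.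
apply: (@cubical_itv_ins (x :: L1) L2 L1 (rcons L2 x)) => //=.
- by rewrite HN2 xN.
- by rewrite -rcons_cat perm_sym perm_rcons.
rewrite -rcons_cat; apply: IH.
- by move: Hn; rewrite !size_cat /= addnS.
- move: Hu; rewrite /= !mem_cat !cat_uniq /= inE !negb_or.
  by case/andP=> /and3P[-> _ ->] /and3P[-> /andP[_ ->] /andP[_ ->]].
by move: HL; rewrite !all_cat /= => /and3P[-> _ ->].
Qed.

Lemma linval_rev (f : nat -> R) s :
  linval (fun i => f (size s - i.+1)) (rev s) = linval f s.
Proof.
elim: s f => [|x s IH] f //=; rewrite rev_cons -cats1 linval_cat /= size_rev.
rewrite addn0 subnn addr0 addrC; congr (_ + _)%R.
rewrite -IH; apply: eq_linval => i; rewrite size_rev => Hi; congr f; lia.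
Qed.

Lemma cubical_rev E d n : (forall z, E z -> size z = n) ->
  cubical R E d -> cubical R (fun z => E (rev z)) d.
Proof.
move=> Hn [F [H1 H2]].
pose G m b : (nat -> R) * R := (fun i => (F m b).1 (n - i.+1), (F m b).2).
have key z A : E z -> pattern F d z A -> pattern G d (rev z) A.
  by move=> Ez HA m b Hm; rewrite /affval /= -(Hn _ Ez) linval_rev; apply: HA.
exists G; split=> [z Ez|A].
  by have [A HA] := H1 _ Ez; exists A; rewrite -[z]revK; apply: key.
by have [z Ez HA] := H2 A; exists (rev z); [rewrite revK | apply: key].
Qed.

Lemma last_rev (T : Type) (y : T) (s : seq T) : last y (rev s) = head y s.
Proof. by case: s => //= e s; rewrite rev_cons last_rcons. Qed.

Definition cross x L c a U :=
  [/\ uniq (x :: L ++ c :: a :: U), all (ltn x) L, x < a, c < a & all (ltn c) U].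

Definition lower x L c a U : seq nat := x :: L ++ c :: a :: U.
Definition upper x L c a U : seq nat := L ++ a :: x :: rcons U c.

(** The filters discard the letters above [a], which the induction deletes before it reaches the
    case where [a] is largest. The defaults [x] and [c] make this the last letter of x L and the
    first letter of U c after deletion. *)
Definition split_cond x L c a U :=
  (last x (filter (ltn^~ a) L) < c) || (head c (filter (ltn^~ a) U) < x).

(** The exponent is the length of the words minus one. The excess of one in the second case is what
    the insertion of a letter preserves. *)
Definition dichotomy x L c a U :=
  let E := itv (lower x L c a U) (upper x L c a U) in
  if split_cond x L c a U then cubical R E (size L + size U).+2
  else atleast E (2 ^ (size L + size U).+2).+1.

Lemma perm_lower_upper x L c a U :
  perm_eq (lower x L c a U) (upper x L c a U).
Proof.
rewrite /upper /lower -cat_cons; apply/seq.permP => p.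
rewrite -cats1 !count_cat /= !count_cat /=; lia.
Qed.

Lemma size_lower x L c a U : size (lower x L c a U) = (size L + size U).+3.
Proof. by rewrite /= size_cat /= !addnS. Qed.

Lemma lower_rev x L c a U : lower c (rev U) x a (rev L) = rev (upper x L c a U).
Proof.
by rewrite /lower /upper rev_cat !rev_cons rev_rcons -!cats1 /= -!catA.
Qed.

Lemma upper_rev x L c a U : upper c (rev U) x a (rev L) = rev (lower x L c a U).
Proof.
by rewrite /lower /upper rev_cons rev_cat !rev_cons -!cats1 -!catA.
Qed.

Lemma cross_rev x L c a U : cross x L c a U -> cross c (rev U) x a (rev L).
Proof.
case=> Hu H1 H2 H3 H4; split=> //; rewrite ?all_rev //.
rewrite -/(lower _ _ _ _ _) lower_rev rev_uniq.
by rewrite -(perm_uniq (perm_lower_upper _ _ _ _ _)).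
Qed.

Lemma itv_lower_rev x L c a U z :
  itv (lower c (rev U) x a (rev L)) (upper c (rev U) x a (rev L)) (rev z) <->
  itv (lower x L c a U) (upper x L c a U) z.
Proof.
rewrite lower_rev upper_rev; split; last exact/itv_rev/perm_lower_upper.
move=> H; have := itv_rev _ H; rewrite !revK; apply.
rewrite perm_rev perm_sym perm_rev; exact: perm_lower_upper.
Qed.

(** Reversal turns the interval upside down, interchanges (x, L) with (c, U) reversed, and swaps the
    two alternatives of [split_cond]. *)
Lemma dichotomy_rev x L c a U : dichotomy c (rev U) x a (rev L) ->
  dichotomy x L c a U.
Proof.
rewrite /dichotomy /split_cond !filter_rev last_rev !size_rev addnC orbC.
have -> : head x (rev (filter (ltn^~ a) L)) = last x (filter (ltn^~ a) L).
  by rewrite -last_rev revK.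
case: ifP => _ H.
  apply: eq_cubical (cubical_rev (n := (size L + size U).+3) _ H) => z.
    exact: itv_lower_rev.
  by case=> /perm_size -> _ _; rewrite size_lower !size_rev addnC.
apply: (atleast_map (h := rev) _ _ H) => [y z _ _ /(can_inj revK) //|z Hz].
by apply/itv_lower_rev; rewrite revK.
Qed.

Lemma dichotomy_ins x L1 L2 c a U N :
  a < N -> all (ltn^~ N) (x :: (L1 ++ L2) ++ c :: a :: U) ->
  dichotomy x (L1 ++ L2) c a U -> dichotomy x (L1 ++ N :: L2) c a U.
Proof.
move=> aN HN; rewrite /dichotomy /split_cond !filter_cat /=.
have -> : (N < a) = false by lia.
rewrite !size_cat /= addnS addSn.
have El : lower x (L1 ++ N :: L2) c a U = (x :: L1) ++ N :: (L2 ++ c :: a :: U).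
  by rewrite /lower /= -catA.
have Eu : upper x (L1 ++ N :: L2) c a U = L1 ++ N :: (L2 ++ a :: x :: rcons U c).
  by rewrite /upper /= -catA.
have El' : lower x (L1 ++ L2) c a U = (x :: L1) ++ (L2 ++ c :: a :: U).
  by rewrite /lower /= -catA.
have Eu' : upper x (L1 ++ L2) c a U = L1 ++ (L2 ++ a :: x :: rcons U c).
  by rewrite /upper /= -catA.
have Hp := perm_lower_upper x (L1 ++ L2) c a U.
rewrite El Eu El' Eu' in Hp *; rewrite -catA in HN.
case: ifP => _ H; first exact: (@cubical_itv_ins (x :: L1) _ L1).
apply: atleast_leq (@atleast_itv_ins (x :: L1) _ L1 _ N erefl HN Hp _ H).
by rewrite [X in X < _]expnS mul2n -addnn; lia.
Qed.

Section Base.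
Variables (x c a : nat) (L U : seq nat).
Hypothesis HX : cross x L c a U.
Hypothesis HL : all (ltn^~ a) L.
Hypothesis HU : all (ltn^~ a) U.

Lemma base_cubical : last x L < c ->
  cubical R (itv (lower x L c a U) (upper x L c a U)) (size L + size U).+2.
Proof.
move=> bc; have [Hu HxL xa ca HcU] := HX.
have [Hu1 Hu2] : uniq (x :: L) /\ uniq (c :: a :: U).
  by move: Hu; rewrite -cat_cons cat_uniq => /and3P[].
pose E0 := itv (lower x L c a U) (rcons L x ++ rcons (a :: U) c).
have E0E z : E0 z <-> exists z1 z2, [/\ z = z1 ++ z2,
    itv (x :: L) (rcons L x) z1 & itv (c :: a :: U) (rcons (a :: U) c) z2].
  split; first by apply: (@itv_cat_inv (x :: L)); rewrite perm_sym perm_rcons.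
  move=> [z1 [z2 [-> H1 H2]]]; apply: (itv_cat (v1 := x :: L)) H2 => //.
  by case: H1 => /perm_size -> _ _; rewrite size_rcons.
(* The factors are cycles moving [x] through [L] and [c] through [a :: U]; the exchange will supply
   the one missing dimension. *)
have C0 : cubical R E0 (size L + (size U).+1).
  apply: eq_cubical (cubical_cat (k := (size L).+1) _ (cubical_cycle Hu1 HxL)
     (cubical_cycle (L := a :: U) Hu2 _)) => [z|z [/perm_size ->]|//].
  - by split=> /E0E.
  - by [].
  by rewrite /= ca HcU.
have Edec A p q B : size A = size L -> E0 (A ++ p :: q :: B) ->
    [/\ p < q, sumn A + p = sumn (x :: L) & q + sumn B = sumn (c :: a :: U)].
  move=> HA /E0E [z1 [z2 [Ez [Hp1 H1 _] [Hp2 H2 _]]]].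
  have Ez' : rcons A p ++ q :: B = z1 ++ z2 by rewrite cat_rcons.
  move/eqP: Ez'; rewrite eqseq_cat; last by rewrite size_rcons HA (perm_size Hp1).
  case/andP=> /eqP Ez1 /eqP Ez2; rewrite -{}Ez1 -{}Ez2 in Hp1 H1 Hp2 H2.
  (* [A] has at least as many letters above any threshold as x L without its last letter, while the
     totals agree; at threshold [p] this leaves at most the last letter to match [p]. *)
  have Hpb : p <= last x L.
    have Hc : count (leq p) (belast x L) <= count (leq p) A.
      rewrite lastI -!cats1 in H1; apply: (dom_cat_count H1).
      by rewrite size_belast HA.
    move: (seq.permP Hp1 (leq p)); rewrite lastI -!cats1 !count_cat /= leqnn; lia.
  have Hqc : c <= q.
    by have := H2 1 c; rewrite !rank_cons !rank0 leqnn; lia.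
  split; first exact: leq_trans (leq_ltn_trans Hpb bc) Hqc.
    by rewrite -(perm_sumn Hp1) -cats1 sumn_cat /= addn0.
  by rewrite -(perm_sumn Hp2).
have -> : (size L + size U).+2 = (size L + (size U).+1).+1 by rewrite addnS.
have El : lower x L c a U = belast x L ++ last x L :: c :: a :: U.
  by rewrite -cat_rcons -lastI.
apply: (cubical_exchange (k := size L) _ Edec _ C0).
  move=> z /E0E [z1 [z2 [-> [Hp1 _ _] [Hp2 _ _]]]].
  have := perm_size Hp1; have := perm_size Hp2.
  case: z2 {Hp2} => [|q B] //; case/lastP: z1 {Hp1} => [|A p] //= _.
  rewrite size_rcons => -[HA]; exists A, p, q, B; split=> //.
  by rewrite cat_rcons.
rewrite /E0 El cat_rcons /= => z; split.
  move/(itv_exchange_inv (ltnW bc) (ltnW xa)).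
  rewrite size_belast => /(_ erefl) [A [p [q [B [_ HA HE Hz]]]]].
  by exists A, p, q, B.
move=> [A [p [q [B [HA HE Hz]]]]].
have [pq _ _] : [/\ p < q, sumn A + p = sumn (x :: L) & q + sumn B = sumn (c :: a :: U)].
  by apply: Edec => //; rewrite /E0 El cat_rcons.
have := itv_exchange (ltnW bc) (ltnW xa) (ltnW pq) _ _ HE.
by rewrite size_belast HA => -[] // H1 H2; case: Hz => ->.
Qed.

(* (size L).+2 is the place of a in the lower word. *)
Lemma base_right : x < head c U ->
  (forall d U1, U = d :: U1 -> dichotomy x L c d U1) ->
  atleast (fun z => itv (lower x L c a U) (upper x L c a U) z /\
             nth 0 z (size L).+2 = a) (2 ^ (size L + size U).+1).
Proof.
move=> xd IH; have [Hu HxL xa ca HcU] := HX.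
(* Without [a], the lower word is x L c U; as upper word take L d x U2. When U is nonempty this is
   the crossed pair with peak [d]; when U is empty, d = c and it is the cycle of [x] through L c. *)
pose d := head c U; pose U2 := behead (rcons U c).
have da : d <= a.
  by rewrite /d; case: (U) HU => [|y s] /=; [rewrite ltnW | case/andP=> /ltnW].
have EU : rcons U c = d :: U2 by rewrite /d /U2; case: (U).
have : atleast (itv (x :: L ++ c :: U) (L ++ d :: x :: U2)) (2 ^ (size L + size U).+1).
  rewrite /d /U2; case EU': U IH => [|y s] IH /=.
    rewrite addn0.
    have := @cubical_cycle x (rcons L c); rewrite size_rcons -cats1 -cats1 -catA /= => H.
    apply: cubical_atleast (H _ _).
      move: Hu; rewrite -cat_cons cat_uniq /= => /and4P[H1 /norP[H2 _] _ _].
      by rewrite -[X in is_true X]/(uniq ((x :: L) ++ [:: c])) cats1 rcons_uniq H2.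
    by rewrite all_cat HxL /= andbT; move: xd; rewrite EU'.
  have := IH _ _ erefl; rewrite /dichotomy addnS; case: ifP => _ H.
    exact: cubical_atleast H.
  exact: atleast_leq H.
apply: (atleast_map (h := ins (size L).+2 a)) => [y z|z].
  move=> [/perm_size Hy _ _] [/perm_size Hz _ _].
  by apply: ins_inj; rewrite ?Hy ?Hz /= size_cat /= addnS !ltnS leq_addr.
move=> [Hp H1 H2]; have Hz : (size L).+2 <= size z.
  by rewrite (perm_size Hp) /= size_cat /= addnS !ltnS leq_addr.
split; last exact: nth_ins.
have El : lower x L c a U = (x :: rcons L c) ++ a :: U.
  by rewrite /lower /= cat_rcons.
have El' : x :: L ++ c :: U = (x :: rcons L c) ++ U by rewrite /= cat_rcons.
have Eu' : L ++ d :: x :: U2 = (rcons (rcons L d) x) ++ U2 by rewrite !cat_rcons.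
rewrite El' Eu' -(cat_take_drop (size L).+2 z) in Hp H1 H2.
split.
- by rewrite El perm_ins.
- by rewrite El; apply/dom_ins => //; rewrite size_takel //= size_rcons.
apply: dom_trans (_ : dom ((rcons (rcons L d) x) ++ a :: U2) _).
  by apply/dom_ins => //; rewrite size_takel // !size_rcons.
(* Putting [a] back gives L d x a U2, which becomes the true upper word L a x d U2 by interchanging
   [d] with the larger [a]. *)
rewrite /upper EU !cat_rcons; exact: (@dom_swap L d [:: x] a U2).
Qed.

(** Inserting [a] between a word of [xL, Lx] and one of [cU, Uc] gives words between x L a c U and L
    x a U c, and these two lie in the interval. *)
Lemma base_middle :
  atleast (fun z => itv (lower x L c a U) (upper x L c a U) z /\
             nth 0 z (size L).+1 = a) (2 ^ (size L + size U)).
Proof.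
have [Hu HxL xa ca HcU] := HX.
have [Hu1 Hu2] : uniq (x :: L) /\ uniq (c :: U).
  move: Hu; rewrite -cat_cons cat_uniq => /and3P[-> _] /=.
  by rewrite inE negb_or => /andP[/andP[_ ->] /andP[_ ->]].
have := cubical_atleast (cubical_cat (k := (size L).+1) _ (cubical_cycle Hu1 HxL)
     (cubical_cycle Hu2 HcU)).
have Hk z : itv (x :: L) (rcons L x) z -> size z = (size L).+1.
  by case=> /perm_size.
move/(_ Hk); apply: (atleast_map (h := ins (size L).+1 a)) => [y z|z].
  move=> [y1 [y2 [-> /Hk Hy _]]] [z1 [z2 [-> /Hk Hz _]]].
  by apply: ins_inj; rewrite size_cat ?Hy ?Hz leq_addr.
move=> [z1 [z2 [-> Hz1 Hz2]]]; have Hz := Hk _ Hz1.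
have -> : ins (size L).+1 a (z1 ++ z2) = z1 ++ a :: z2.
  by rewrite /ins -Hz take_size_cat // drop_size_cat.
split; last by rewrite -Hz nth_cat ltnn subnn.
case: Hz1 => Hp1 H11 H12; case: Hz2 => Hp2 H21 H22; split.
- rewrite /lower -cat_cons; apply: (@perm_trans _ ((x :: L) ++ a :: c :: U)).
    by rewrite perm_ins perm_cat.
  by rewrite perm_cat2l (perm_catCA [:: a] [:: c] U).
- apply: (@dom_trans ((x :: L) ++ a :: c :: U)).
    exact: (@dom_swap (x :: L) c [::] a U (ltnW ca)).
  by apply/dom_ins; rewrite ?Hz //; apply: dom_cat.
apply: (@dom_trans (rcons L x ++ a :: rcons U c)).
  by apply/dom_ins; [rewrite size_rcons | apply: dom_cat; rewrite ?size_rcons].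
by rewrite cat_rcons; apply: (@dom_swap L x [::] a _ (ltnW xa)).
Qed.

End Base.

Theorem cross_dichotomy x L c a U : cross x L c a U -> dichotomy x L c a U.
Proof.
move: {2}(size L + size U) (leqnn (size L + size U)) => n.
elim/ltn_ind: n x L c a U => n IH x L c a U Hn HX.
have IHs y M e f V : size M + size V < size L + size U -> cross y M e f V ->
    dichotomy y M e f V.
  by move=> H; apply: (IH (size M + size V)) => //; apply: leq_trans H Hn.
clear IH n Hn.
have HinsL y M e f V N : size M + size V = size L + size U -> cross y M e f V ->
    N \in M -> f < N -> all (leq^~ N) (lower y M e f V) -> dichotomy y M e f V.
  move=> Hs HX' NM fN HN; have [L1 [L2 EL]] := mem_split NM; subst M.
  have [Hu HxL xa ca HcU] := HX'.
  have HN' : all (ltn^~ N) (y :: (L1 ++ L2) ++ e :: f :: V).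
    have := @uniq_max_lt (y :: L1) (L2 ++ e :: f :: V) N.
    by rewrite /= -!catA /=; apply; move: Hu HN; rewrite /lower -catA.
  apply: dichotomy_ins => //; apply: IHs; first by rewrite -Hs !size_cat /=; lia.
  split=> //; last by move: HxL; rewrite !all_cat /= => /and3P[-> _ ->].
  have := perm_uniq (permEl (perm_catCA (y :: L1) [:: N] (L2 ++ e :: f :: V))).
  rewrite /= -!catA /= in Hu *; rewrite Hu => /esym.
  by case/andP.
have [N NI HN] := @max_mem (lower x L c a U) isT.
have [Hu HxL xa ca HcU] := HX.
have [Na|] := eqVneq N a; last first.
  move=> Na; have aN : a < N.
    rewrite ltn_neqAle eq_sym Na (allP HN) //.
    by rewrite /lower inE mem_cat !inE eqxx !orbT.
  move: NI; rewrite /lower inE mem_cat !inE (negbTE Na).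
  rewrite !gtn_eqF ?(ltn_trans _ aN) //= => /orP[NL|NU]; first exact: HinsL HN.
  apply/dichotomy_rev; apply: (HinsL _ _ _ _ _ N) => //.
  - by rewrite !size_rev addnC.
  - exact: cross_rev.
  - by rewrite mem_rev.
  by rewrite lower_rev all_rev -(perm_all _ (perm_lower_upper _ _ _ _ _)).
rewrite {}Na {N NI} in HN.
have [HL HU] : all (ltn^~ a) L /\ all (ltn^~ a) U.
  have := @uniq_max_lt (x :: rcons L c) U a; rewrite /= cat_rcons.
  move=> /(_ Hu HN) /andP[_]; rewrite cat_rcons all_cat /=.
  by case/and3P.
have [HLr HUr] : all (ltn^~ a) (rev L) /\ all (ltn^~ a) (rev U).
  by rewrite !all_rev.
have HXr := cross_rev HX.
rewrite /dichotomy /split_cond.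
rewrite (all_filterP HL) (all_filterP HU).
case: ifP => [/orP[bc|dx]|/norP[]]; first exact: base_cubical.
  have := dichotomy_rev (x := x) (L := L) (c := c) (a := a) (U := U).
  rewrite /dichotomy /split_cond !filter_rev !(all_filterP _) // last_rev dx orbT /=.
  by apply; apply: base_cubical => //; rewrite last_rev.
rewrite -!leqNgt => cb xd.
have xd' : x < head c U.
  rewrite ltn_neqAle xd andbT; move: Hu; rewrite /= mem_cat !inE !negb_or.
  case: (U) => [|y s] /= /andP[/and4P[_ h1 _]]; first by rewrite h1.
  by rewrite inE negb_or => /andP[].
have cb' : c < last x L.
  have ncL : c \notin x :: L.
    by move: Hu; rewrite -cat_cons cat_uniq /= => /and4P[_ /norP[]].
  by rewrite ltn_neqAle cb andbT; apply: contraNneq ncL => ->; apply: mem_last.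
(* Once the peak [f] is deleted, the first letter [d] of [V] takes its role, so the hypothesis of
   [base_right] is a smaller case of the induction. *)
have HIH y M e f V : cross y M e f V -> size M + size V = size L + size U ->
    y < head e V -> forall d V1, V = d :: V1 -> dichotomy y M e d V1.
  move=> [Hu' HM yf ef HeV] Hs yd d V1 EV; subst V; apply: IHs.
    by rewrite -Hs /= addnS.
  have /andP[ed HeV1] : (e < d) && all (ltn e) V1 := HeV.
  split=> //; apply: subseq_uniq Hu'.
  by rewrite -!cat_cons -!(cat_rcons e) cat_subseq // subseq_cons.
have H1 := base_right HX HU xd' (HIH _ _ _ _ _ HX erefl xd').
have cb'' : c < head x (rev L) by rewrite -last_rev revK.
have Hs : size (rev U) + size (rev L) = size L + size U by rewrite !size_rev addnC.
have H3 := base_right HXr HLr cb'' (HIH _ _ _ _ _ HXr Hs cb'').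
pose P i z := itv (lower x L c a U) (upper x L c a U) z /\ nth 0 z i = a.
(* Place [(size U).+2] of the reversed word is place [size L] of the word itself. *)
have {}H3 : atleast (P (size L)) (2 ^ (size L + size U).+1).
  rewrite -Hs; apply: (atleast_map (h := rev) _ _ H3) => [y z _ _ /(can_inj revK) //|z].
  move=> [Hz Ez]; split; first by apply/itv_lower_rev; rewrite revK.
  have Sz : size z = (size L + size U).+3.
    by case: Hz => /perm_size ->; rewrite size_lower Hs.
  rewrite nth_rev Sz; last by lia.
  by rewrite -Ez size_rev; congr nth; lia.
have Pdis i j z : i != j -> P i z -> P j z -> False.
  have ha : 0 < a by apply: leq_ltn_trans xa.
  move=> /negP ij [[Hp _ _] Hi] [_ Hj]; apply: ij.
  have Hsz k : nth 0 z k = a -> k < size z.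
    by case: ltnP => // Hk; rewrite nth_default // => E; rewrite -E in ha.
  by rewrite -(nth_uniq 0 (Hsz _ Hi) (Hsz _ Hj)) ?Hi ?Hj // (perm_uniq Hp).
have H12 : atleast (fun z => P (size L).+2 z \/ P (size L).+1 z)
    (2 ^ (size L + size U).+1 + 2 ^ (size L + size U)).
  apply: (atleast_or _ _ H1 (base_middle HX)) => // z.
  by apply: Pdis; lia.
have H123 : atleast (itv (lower x L c a U) (upper x L c a U))
    (2 ^ (size L + size U).+1 + 2 ^ (size L + size U) + 2 ^ (size L + size U).+1).
  apply: (atleast_or _ _ H12 H3) => [z|z]; last by case=> [[]|] [].
  by case; apply: Pdis; lia.
apply: atleast_leq H123; rewrite !expnS.
by have := expn_gt0 2 (size L + size U); lia.
Qed.

End Cross.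

(** * Linear functionals, convex hulls and faces *)

Section Faces.
Variable R : realType.
Local Open Scope classical_set_scope.
Local Open Scope ring_scope.

Definition dotmx n (a x : 'rV[R]_n) : R := \sum_i a 0 i * x 0 i.

Lemma dotmxC n (a x : 'rV[R]_n) : dotmx a x = dotmx x a.
Proof. by apply: eq_bigr => i _; rewrite mulrC. Qed.

Lemma dotmx_is_linear n (a : 'rV[R]_n) : linear (dotmx a : 'rV[R]_n -> R^o).
Proof.
move=> c x y; rewrite /dotmx scaler_sumr -big_split; apply: eq_bigr => i _ /=.
by rewrite !mxE mulrDr mulrCA.
Qed.

HB.instance Definition _ n (a : 'rV[R]_n) :=
  GRing.isLinear.Build R 'rV[R]_n R^o *:%R (dotmx a) (dotmx_is_linear a).

Lemma dotmxDl n (a b x : 'rV[R]_n) : dotmx (a + b) x = dotmx a x + dotmx b x.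
Proof. by rewrite !(dotmxC _ x) linearD. Qed.

Lemma dotmxZl n c (a x : 'rV[R]_n) : dotmx (c *: a) x = c * dotmx a x.
Proof. by rewrite !(dotmxC _ x) linearZ. Qed.

Lemma dotmxNl n (a x : 'rV[R]_n) : dotmx (- a) x = - dotmx a x.
Proof. by rewrite !(dotmxC _ x) linearN. Qed.

Lemma dotmx_sqrB n (x y : 'rV[R]_n) :
  dotmx (x - y) (x - y) = dotmx x x - dotmx x y *+ 2 + dotmx y y.
Proof. by rewrite linearB /= !dotmxDl !dotmxNl (dotmxC y x); ring. Qed.

Lemma dotmx_suml n I (r : seq I) (P : pred I) (a : I -> 'rV[R]_n) x :
  dotmx (\sum_(i <- r | P i) a i) x = \sum_(i <- r | P i) dotmx (a i) x.
Proof. by rewrite dotmxC linear_sum; apply: eq_bigr => i _; apply: dotmxC. Qed.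

Lemma dotmx_eq0 n (x : 'rV[R]_n) : (dotmx x x == 0) = (x == 0).
Proof.
rewrite psumr_eq0 => [|i _]; last by rewrite -expr2 sqr_ge0.
apply/allP/eqP => [H|-> i _]; last by rewrite /= !mxE mulr0.
apply/rowP => i; rewrite mxE; apply/eqP.
by have := H i (mem_index_enum _); rewrite /= mulf_eq0 orbb.
Qed.

Lemma dotmx_ge0 n (x : 'rV[R]_n) : 0 <= dotmx x x.
Proof. by apply: sumr_ge0 => i _; rewrite -expr2 sqr_ge0. Qed.

(** The matrix of pairings is triangular with nonzero diagonal, hence invertible, and it factors
    through dimension n. Both dimension bounds below rest on this. *)
Lemma triangular_leq n N (phi x : 'I_N -> 'rV[R]_n) :
  (forall i j : 'I_N, (i < j)%N -> dotmx (phi i) (x j) = 0) ->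
  (forall i, dotmx (phi i) (x i) != 0) -> (N <= n)%N.
Proof.
move=> H0 H1.
pose X := \matrix_(j < n, i < N) x i 0 j; pose F := \matrix_(i < N, j < n) phi i 0 j.
have E i j : (F *m X) i j = dotmx (phi i) (x j).
  by rewrite mxE; apply: eq_bigr => k _; rewrite !mxE.
have T : is_trig_mx (F *m X) by apply/is_trig_mxP => i j ij; rewrite E H0.
have U : F *m X \in unitmx.
  rewrite unitmxE det_trig // unitfE; apply/prodf_neq0 => i _; rewrite E; exact: H1.
by rewrite -{1}(mxrank_unit U) mulmx_max_rank.
Qed.

Definition convexr n (A : set 'rV[R]_n) := forall x y t,
  0 <= t <= 1 -> A x -> A y -> A (t *: x + (1 - t) *: y).

Lemma convexrP n (A : set 'rV[R]_n) : convexr A -> @convex_set R 'rV[R]_n A.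
Proof.
move=> H x y l; rewrite !inE => Ax Ay; apply: H => //.
by rewrite ge0 le1.
Qed.

Lemma convex_convexr n (A : set 'rV[R]_n) : @convex_set R 'rV[R]_n A -> convexr A.
Proof.
move=> H x y t t01 Ax Ay.
have := H x y (Itv01 (proj1 (andP t01)) (proj2 (andP t01))).
by rewrite !inE; apply.
Qed.

Lemma conv_hull_sub n (A B : set 'rV[R]_n) :
  convexr B -> A `<=` B -> conv_hull A `<=` B.
Proof. by move=> /convexrP HB AB; apply: smallest_sub. Qed.

Lemma sub_conv_hull n (A : set 'rV[R]_n) : A `<=` conv_hull A.
Proof. exact: sub_gen_smallest. Qed.

Lemma convex_conv_hull n (A : set 'rV[R]_n) : convexr (conv_hull A).
Proof.
move=> x y t t01 Ax Ay B [HB AB].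
by apply: (convex_convexr HB) => //; [apply: Ax | apply: Ay].
Qed.

Lemma dotmx_conv n (a x y : 'rV[R]_n) t :
  dotmx a (t *: x + (1 - t) *: y) = t * dotmx a x + (1 - t) * dotmx a y.
Proof. by rewrite linearD !linearZ. Qed.

Lemma dotmx_conv_le n (A : set 'rV[R]_n) a b :
  (forall x, A x -> dotmx a x <= b) -> forall x, conv_hull A x -> dotmx a x <= b.
Proof.
move=> H; apply: conv_hull_sub => // x y t /andP[t0 t1] Hx Hy.
by rewrite dotmx_conv; nra.
Qed.

Lemma faceP n (P F : set 'rV[R]_n) : faces P F <-> exists a b,
  (forall x, P x -> dotmx a x <= b) /\ F = [set x | P x /\ dotmx a x = b].
Proof. by []. Qed.

(** The points of the hull that are off [F] or in [G] form a convex set: a proper combination lies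
    on a supporting hyperplane only if both ends do. This set contains the generators, hence the
    hull. *)
Lemma face_sub n (A F G : set 'rV[R]_n) : faces (conv_hull A) F -> convexr G ->
  (forall x, A x -> F x -> G x) -> F `<=` G.
Proof.
move=> /faceP [a [b [Hab ->]]] HG H x [Px Ex].
suff : conv_hull A `<=` [set y | conv_hull A y /\ (dotmx a y = b -> G y)].
  by move=> /(_ x Px) [_]; apply.
apply: conv_hull_sub => [y z t t01 [Py Gy] [Pz Gz]|y Ay]; last first.
  by have Py := sub_conv_hull Ay; split=> // Ey; apply: H.
split; first exact: convex_conv_hull.
rewrite dotmx_conv => E; have hy := Hab _ Py; have hz := Hab _ Pz.
have [/eqP t0|tn0] := boolP (t == 0).
  rewrite t0 scale0r add0r subr0 scale1r; apply: Gz; move: E; rewrite t0; lra.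
have [/eqP t1|tn1] := boolP (t == 1).
  rewrite t1 subrr scale0r addr0 scale1r; apply: Gy; move: E; rewrite t1; lra.
have t0 : 0 < t by rewrite lt_neqAle eq_sym tn0; case/andP: t01.
have t1 : 0 < 1 - t by rewrite subr_gt0 lt_neqAle tn1; case/andP: t01.
have h1 : 0 <= t * (b - dotmx a y) by rewrite mulr_ge0 ?subr_ge0 // ltW.
have h2 : 0 <= (1 - t) * (b - dotmx a z) by rewrite mulr_ge0 ?(ltW t1) // subr_ge0.
have h3 : t * (b - dotmx a y) = 0 by nra.
have h4 : (1 - t) * (b - dotmx a z) = 0 by nra.
apply: HG => //; [apply: Gy | apply: Gz]; apply/eqP.
  by move/eqP: h3; rewrite mulf_eq0 gt_eqF //= subr_eq0 eq_sym.
by move/eqP: h4; rewrite mulf_eq0 gt_eqF //= subr_eq0 eq_sym.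
Qed.

Lemma convex_face n (A F : set 'rV[R]_n) : faces (conv_hull A) F -> convexr F.
Proof.
move=> /faceP [a [b [Hab ->]]] x y t t01 [Px Ex] [Py Ey].
by split; [apply: convex_conv_hull | rewrite dotmx_conv Ex Ey; ring].
Qed.

Lemma face_set0 n (P : set 'rV[R]_n) : faces P set0.
Proof.
apply/faceP; exists 0, 1; split=> [x _|]; first by rewrite dotmxC linear0.
by apply/seteqP; split=> // x [_]; rewrite dotmxC linear0 => /eqP; rewrite eq_sym oner_eq0.
Qed.

End Faces.

(** * Recognising a combinatorial cube from its facet functionals *)

Section CubeRecognition.
Variable R : realType.
Local Open Scope classical_set_scope.
Local Open Scope ring_scope.

(** The corner sets of the faces of the cube; [M] is the set of free directions. *)
Definition cube_family d (S : set {ffun 'I_d -> bool}) :=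
  S = set0 \/ exists A (M : {set 'I_d}),
    S = [set B | forall m, m \notin M -> B m = A m].

(** Reading off the labels of the corners identifies the face poset with that of [cube_family]; two
    polytopes are then compared through this common model. *)
Definition cube_like n d (P : set 'rV[R]_n) :=
  exists p : {ffun 'I_d -> bool} -> 'rV[R]_n,
  [/\ forall F, faces P F -> cube_family (p @^-1` F),
      forall S, cube_family S -> exists2 F, faces P F & p @^-1` F = S
    & forall F G, faces P F -> faces P G ->
        (F `<=` G <-> p @^-1` F `<=` p @^-1` G)].

Lemma cube_like_equiv n m d (P : set 'rV[R]_n) (Q : set 'rV[R]_m) :
  cube_like d P -> cube_like d Q -> comb_equiv P Q.
Proof.
move=> [p [p1 p2 p3]] [q [q1 q2 q3]].
have /choice [f Hf] : forall F, exists G, faces P F -> faces Q G /\ q @^-1` G = p @^-1` F.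
  move=> F; have [/p1/q2[G HG EG]|nF] := pselect (faces P F); first by exists G.
  by exists set0.
exists f; split; last first.
  move=> F G HF HG; have [fF EF] := Hf _ HF; have [fG EG] := Hf _ HG.
  by rewrite p3 // q3 // EF EG.
split; first by move=> F /Hf[].
- move=> F G; rewrite !inE => HF HG E.
  have [fF EF] := Hf _ HF; have [fG EG] := Hf _ HG.
  by apply/seteqP; split; apply/p3 => //; rewrite -EF -EG E.
move=> G HG; have [F HF EF] := p2 _ (q1 _ HG); exists F => //.
have [fF EF'] := Hf _ HF.
by apply/seteqP; split; apply/q3 => //; rewrite EF' EF.
Qed.

Section Recognition.
Variables (n d : nat) (V : set 'rV[R]_n) (u : 'rV[R]_n) (kappa : R).
Variables (alpha : 'I_d -> bool -> 'rV[R]_n) (beta : 'I_d -> bool -> R).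

Definition affmx m e x := dotmx (alpha m e) x + beta m e.

Definition patternmx x (A : {ffun 'I_d -> bool}) := forall m e,
  if A m == e then affmx m e x = 0 else 0 < affmx m e x.

Hypothesis Vu : forall x, V x -> dotmx u x = kappa.
Hypothesis V_pattern : forall x, V x -> exists A, patternmx x A.
Hypothesis pattern_V : forall A, exists2 x, V x & patternmx x A.
(** This bounds the dimension by d, so that a point is determined by the values at it of the d
    functionals vanishing at a given vertex. *)
Hypothesis span : forall (A : {ffun 'I_d -> bool}) y, dotmx u y = 0 ->
  (forall m, dotmx (alpha m (A m)) y = 0) -> y = 0.

Lemma cube_recognition : cube_like d (conv_hull V).
Proof.
have /choice [p Hp] : forall A, exists x, V x /\ patternmx x A.
  by move=> A; have [x] := pattern_V A; exists x.
pose flip (A : {ffun 'I_d -> bool}) (m : 'I_d) : {ffun 'I_d -> bool} := [ffun i => if i == m then ~~ A i else A i].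
pose e A (m : 'I_d) := p (flip A m) - p A.
have aff0 (A : {ffun 'I_d -> bool}) m : affmx m (A m) (p A) = 0.
  by have := (Hp A).2 m (A m); rewrite eqxx.
have aff_flip (A : {ffun 'I_d -> bool}) m k : affmx k (A k) (p (flip A m)) = 0 <-> k != m.
  have := (Hp (flip A m)).2 k (A k); rewrite ffunE.
  have [->|km] := eqVneq k m; last by rewrite eqxx.
  have -> : (~~ A m == A m) = false by case: (A m).
  by move=> h; split=> // E; rewrite E ltxx in h.
have aff_flip_gt0 (A : {ffun 'I_d -> bool}) m : 0 < affmx m (A m) (p (flip A m)).
  by have := (Hp (flip A m)).2 m (A m); rewrite ffunE eqxx; case: (A m).
(* The coordinates of x - p A along the vectors towards the d neighbours of [p A]: the functional of
   index m that vanishes at [p A] vanishes at all neighbours but the m-th. *)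
pose c (A : {ffun 'I_d -> bool}) x m := affmx m (A m) x / affmx m (A m) (p (flip A m)).
have expand A x : V x -> x - p A = \sum_m c A x m *: e A m.
  move=> Vx; apply/eqP; rewrite -subr_eq0; apply/eqP; apply: (@span A).
    rewrite !linearB linear_sum /= !Vu //; last by have [] := Hp A.
    rewrite subrr sub0r big1 ?oppr0 // => m _.
    rewrite linearZ /= linearB /= !Vu ?subrr ?scaler0 //.
      by have [] := Hp A.
    by have [] := Hp (flip A m).
  move=> m.
  have dotE y : dotmx (alpha m (A m)) y = affmx m (A m) y - beta m (A m).
    by rewrite /affmx addrK.
  rewrite !linearB linear_sum /= !dotE aff0 (bigD1 m) //= big1.
    rewrite linearZ /= linearB /= !dotE aff0 /c.
    have := aff_flip_gt0 A m; set w := affmx _ _ _ => w0.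
    have -> : w - beta m (A m) - (0 - beta m (A m)) = w by ring.
    have -> : (affmx m (A m) x / w) *: (w : R^o) = affmx m (A m) x.
      by rewrite /GRing.scale /= divfK // gt_eqF.
    by ring.
  move=> k km; rewrite linearZ /= linearB /= !dotE aff0.
  have -> : affmx m (A m) (p (flip A k)) = 0 by apply/aff_flip; rewrite eq_sym.
  by rewrite subrr scaler0.
have c_pat (A B : {ffun 'I_d -> bool}) m : 0 <= c A (p B) m /\ (c A (p B) m == 0) = (A m == B m).
  have := (Hp B).2 m (A m); rewrite /c eq_sym; have /ltW h := aff_flip_gt0 A m.
  case: eqP => [_ ->|_ h']; first by rewrite mul0r lexx eqxx.
  split; first by rewrite divr_ge0 // ltW.
  by apply: gt_eqF; rewrite divr_gt0.
have VpE x : V x -> exists A, x = p A.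
  move=> Vx; have [A HA] := V_pattern Vx; exists A; apply/eqP; rewrite -subr_eq0.
  rewrite (expand A) //; apply/eqP/big1 => m _; rewrite /c.
  by have := HA m (A m); rewrite eqxx => ->; rewrite mul0r scale0r.
exists p; split.
- move=> F /faceP [a [b [Hab EF]]].
  have [[A FA]|nF] := pselect (exists A, F (p A)); last first.
    by left; apply/seteqP; split=> // A FA; apply: nF; exists A.
  right; exists A, [set m | dotmx a (p (flip A m)) == b]%SET.
  have Pp B : conv_hull V (p B) by apply: sub_conv_hull; have [] := Hp B.
  have FE B : F (p B) <-> dotmx a (p B) = b.
    by rewrite EF; split=> [[]|] //; split.
  have EA : dotmx a (p A) = b by apply/FE.
  (* The slack at [p B] is a combination of the slacks at the neighbours of [p A], with coefficients
     positive exactly where [A] and [B] differ. So [p B] is in the face iff every such neighbour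
     is. *)
  have key B : b - dotmx a (p B) = \sum_m c A (p B) m * (b - dotmx a (p (flip A m))).
    have := expand A (p B) (Hp B).1; move/(congr1 (dotmx a)).
    rewrite linearB linear_sum /= EA => /(congr1 -%R); rewrite opprB => ->.
    rewrite -sumrN; apply: eq_bigr => m _; rewrite linearZ /= linearB /= EA.
    by rewrite /GRing.scale /=; ring.
  apply/seteqP; split=> B /=.
    move=> /FE EB m; rewrite inE => Hm.
    have /eqP : \sum_m c A (p B) m * (b - dotmx a (p (flip A m))) = 0.
      by rewrite -key EB subrr.
    rewrite psumr_eq0 => [|k _]; last first.
      by rewrite mulr_ge0 ?(c_pat A B k).1 // subr_ge0; apply: Hab.
    move=> /allP /(_ m (mem_index_enum _)); rewrite mulf_eq0 (c_pat A B m).2.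
    by rewrite subr_eq0 eq_sym [b == _]eq_sym (negbTE Hm) orbF => /eqP.
  move=> HB; apply/FE/eqP; rewrite eq_sym -subr_eq0 key; apply/eqP/big1 => m _.
  have [Hm|Hm] := boolP (m \in [set m | dotmx a (p (flip A m)) == b]%SET).
    by move: Hm; rewrite inE => /eqP ->; rewrite subrr mulr0.
  have /eqP -> : c A (p B) m == 0 by rewrite (c_pat A B m).2 HB.
  by rewrite mul0r.
- move=> S [->|[A [M ->]]]; first by exists set0; [apply: face_set0 | ].
  (* A subcube is exposed by the sum of the nonnegative functionals of its fixed directions, which
     vanishes only where all of them do. *)
  pose a := - \sum_(m | m \notin M) alpha m (A m).
  pose b := \sum_(m | m \notin M) beta m (A m).
  have Ea x : b - dotmx a x = \sum_(m | m \notin M) affmx m (A m) x.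
    rewrite /a dotmxNl dotmx_suml opprK /b -big_split /=.
    by apply: eq_bigr => m _; rewrite addrC.
  have aff_ge0 x m k : V x -> 0 <= affmx m k x.
    move=> /V_pattern [B /(_ m k)]; case: ifP => _; last exact: ltW.
    by move=> ->.
  exists [set x | conv_hull V x /\ dotmx a x = b].
    apply/faceP; exists a, b; split=> //; apply: dotmx_conv_le => x Vx.
    by rewrite -subr_ge0 Ea sumr_ge0 // => m _; apply: aff_ge0.
  apply/seteqP; split=> B /=.
    move=> [_ /esym/eqP]; rewrite -subr_eq0 Ea psumr_eq0 => [/allP H m Hm|m _].
      have := H m (mem_index_enum _); rewrite Hm /= => /eqP E.
      by have := (Hp B).2 m (A m); rewrite E; case: eqP => // _; rewrite ltxx.
    by apply: aff_ge0; have [] := Hp B.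
  move=> H; split; first by apply: sub_conv_hull; have [] := Hp B.
  apply/esym/eqP; rewrite -subr_eq0 Ea; apply/eqP/big1 => m Hm.
  by rewrite -(H m Hm).
move=> F G HF HG; split=> [FG A|FG]; first exact: FG.
apply: (face_sub HF (convex_face HG)) => x Vx Fx.
by have [A E] := VpE _ Vx; rewrite E in Fx *; apply: FG.
Qed.

End Recognition.

End CubeRecognition.

(** * The unit cube, and a bound on the vertices of a combinatorial cube *)

Section CubePolytopes.
Variable R : realType.
Local Open Scope classical_set_scope.
Local Open Scope ring_scope.

Lemma dotmx_delta n (m : 'I_n) (x : 'rV[R]_n) : dotmx (delta_mx 0 m) x = x 0 m.
Proof.
rewrite /dotmx (bigD1 m) //= mxE !eqxx mul1r big1 ?addr0 // => k km.
by rewrite mxE (negbTE km) andbF mul0r.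
Qed.

Definition corners d : set 'rV[R]_d := [set x | forall m, x 0 m = 0 \/ x 0 m = 1].

(** Induction on the number of coordinates other than 0 and 1: a point lies on the segment obtained
    by replacing one such coordinate by 0 and by 1. *)
Lemma unit_cube_conv_hull d : @unit_cube R d = conv_hull (@corners d).
Proof.
apply/seteqP; split; last first.
  apply: conv_hull_sub => [x y t /andP[t0 t1] Hx Hy m|x Hx m]; last first.
    by case: (Hx m) => ->; rewrite lexx ler01.
  by rewrite !mxE; have /andP[? ?] := Hx m; have /andP[? ?] := Hy m; nra.
pose S (x : 'rV[R]_d) := [set m : 'I_d | (x 0 m != 0) && (x 0 m != 1)]%SET.
move=> x Hx; move: {2}#|_| (erefl #|S x|) => k.
elim: k x Hx => [|k IH] x Hx.
  move/eqP; rewrite cards_eq0 => /eqP E; apply: sub_conv_hull => m.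
  have : m \notin S x by rewrite E inE.
  by rewrite inE negb_and !negbK => /orP[/eqP|/eqP]; [left|right].
move=> E; have /card_gt0P [m Hm] : (0 < #|S x|)%N by rewrite E.
pose y (e : R) : 'rV[R]_d := \row_i if i == m then e else x 0 i.
have Hy e : e = 0 \/ e = 1 -> conv_hull (@corners d) (y e).
  move=> He; apply: IH => [i|].
    by rewrite mxE; case: eqP => _; [case: He => ->; rewrite lexx ler01 | apply: Hx].
  move: E; rewrite (cardsD1 m) Hm => -[<-]; congr #|pred_of_set _|.
  apply/setP => i; rewrite !inE mxE; case: (eqVneq i m) => //= _.
  by case: He => ->; rewrite eqxx ?andbF.
have -> : x = x 0 m *: y 1 + (1 - x 0 m) *: y 0.
  apply/rowP => i; rewrite !mxE; case: (eqVneq i m) => [->|_]; ring.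
by apply: convex_conv_hull => //; apply: Hy; [right|left].
Qed.

Lemma cube_like_unit d : cube_like d (@unit_cube R d).
Proof.
rewrite unit_cube_conv_hull.
pose alpha (m : 'I_d) (e : bool) : 'rV[R]_d := if e then - delta_mx 0 m else delta_mx 0 m.
pose beta (m : 'I_d) (e : bool) : R := if e then 1 else 0.
have affE m e x : affmx alpha beta m e x = if e then 1 - x 0 m else x 0 m.
  rewrite /affmx /alpha /beta; case: e; last by rewrite dotmx_delta addr0.
  by rewrite dotmxNl dotmx_delta addrC.
apply: (@cube_recognition R d d _ 0 0 alpha beta).
- by move=> x _; rewrite dotmxC linear0.
- move=> x Hx; exists [ffun m => x 0 m == 1] => m e; rewrite ffunE affE.
  by case: (Hx m) => ->; rewrite ?eqxx ?[0 == 1]eq_sym ?oner_eq0; case: e => /=; lra.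
- move=> A; exists (\row_m (A m)%:R) => [m|m e]; first by rewrite mxE; case: (A m); [right|left].
  by rewrite affE mxE; case: (A m); case: e => /=; lra.
move=> A y _ H; apply/rowP => m; rewrite mxE.
have := H m; rewrite /alpha; case: (A m); last by rewrite dotmx_delta.
by rewrite dotmxNl dotmx_delta => /eqP; rewrite oppr_eq0 => /eqP.
Qed.

(* A maximal chain of faces of the d-cube pulls back to a chain of faces, which
   yields d + 1 linearly independent points, so d < n.  The points pt i, lying on
   a sphere, are faces, and inject into the corners of the cube. *)
Lemma comb_cube_card n (I : finType) (pt : I -> 'rV[R]_n) (u : 'rV[R]_n) (kappa rho : R) :
  injective pt -> kappa != 0 -> (forall i, dotmx u (pt i) = kappa) ->
  (forall i, dotmx (pt i) (pt i) = rho) ->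
  comb_cube (conv_hull (range pt)) -> (#|I| <= 2 ^ n.-1)%N.
Proof.
move=> pt_inj k0 Hu Hr [d [f [[f1 f2 f3] f4]]].
set P := conv_hull (range pt) in f f1 f2 f3 f4 *.
have [p [p1 p2 p3]] := cube_like_unit d.
pose g F := p @^-1` f F.
have g_sub F G : faces P F -> faces P G -> (F `<=` G <-> g F `<=` g G).
  by move=> HF HG; rewrite f4 // p3 //; apply: f1.
have g_surj S : cube_family S -> exists2 F, faces P F & g F = S.
  by move=> /p2 [G HG <-]; have [F HF <-] := f3 _ HG; exists F.
have g0 : g set0 = set0.
  have [F0 HF0 E] := g_surj set0 (or_introl erefl).
  apply/seteqP; split=> //; rewrite -[X in _ `<=` X]E.
  by apply/g_sub => //; apply: face_set0.
have g_neq0 F x : faces P F -> F x -> exists A, g F A.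
  move=> HF Fx; apply: contrapT => H.
  have : F `<=` set0.
    by apply/g_sub => //; [exact: face_set0 | move=> A gA; case: H; exists A].
  by move/(_ x Fx).
have Pu x : P x -> dotmx u x = kappa.
  move=> Px; apply/eqP; rewrite eq_le; apply/andP; split.
    by apply: dotmx_conv_le Px => _ [i _ <-]; rewrite Hu.
  rewrite -lerN2 -dotmxNl; apply: dotmx_conv_le Px => _ [i _ <-].
  by rewrite dotmxNl Hu.
have [dn|nd] := ltnP d n; last first.
  (* [S i] frees the first i directions, so [S 0] is a single corner. The point [y i] is taken in
     the i-th face of the flag, outside the preceding one. *)
  pose S i : set {ffun 'I_d -> bool} := [set B | forall m : 'I_d, (i <= m)%N -> B m = false].
  have /choice [F HF] : forall i, exists F, faces P F /\ g F = S i.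
    move=> i; have [|F HF E] := g_surj (S i); last by exists F.
    right; exists [ffun=> false], [set m : 'I_d | (m < i)%N]%SET.
    apply/seteqP; split=> B HB m Hm; rewrite ?ffunE.
      by apply: HB; rewrite inE -leqNgt in Hm.
    by rewrite HB ?ffunE // inE -leqNgt.
  have HFf i := (HF i).1; have HFg i := (HF i).2.
  have F_mono i j : (i <= j)%N -> F i `<=` F j.
    move=> ij; apply/g_sub => //; rewrite !HFg => B HB m Hm.
    by apply: HB; apply: leq_trans Hm.
  have /choice [y Hy] : forall i, exists x, (i <= d)%N ->
      F i x /\ (if i is i'.+1 then ~ F i' x else True).
    move=> i; have [id|] := leqP i d; last by exists 0.
    apply: contrapT => H; case: i id H => [|i] id H.
      have : F 0%N `<=` set0 by move=> x Fx; apply: H; exists x.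
      move/(g_sub _ _ (HFf 0%N) (face_set0 P)); rewrite g0 HFg => /(_ [ffun=> false]).
      by apply=> m _; rewrite ffunE.
    have : F i.+1 `<=` F i.
      move=> x Fx; apply: contrapT => nFx; apply: H; exists x => _.
      by split.
    move/(g_sub _ _ (HFf _) (HFf _)); rewrite !HFg => /(_ [ffun m : 'I_d => m == i :> nat]).
    move=> H'; have : [ffun m : 'I_d => m == i :> nat] (Ordinal id) = false.
      by apply: H' => // m Hm; rewrite ffunE gtn_eqF.
    by rewrite ffunE eqxx.
  have /choice [a Ha] := fun i => (faceP P (F i)).1 (HFf i).
  have {Ha} /choice [b Hab] := Ha.
  (* Since [u] equals [kappa] on P, subtracting a multiple of it makes the affine equation of the
     face linear. *)
  pose phi i := if i is i'.+1 then a i' - (b i' / kappa) *: u else u.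
  have phiE i x : P x -> dotmx (phi i.+1) x = dotmx (a i) x - b i.
    by move=> Px; rewrite /= dotmxDl -scaleNr dotmxZl Pu // mulNr divfK.
  have FP i x : F i x -> P x by rewrite (Hab i).2 => -[].
  suff : (d.+1 <= n)%N by rewrite ltnNge nd.
  (* The index is reversed because [phi i.+1] vanishes on the faces up to the i-th, that is, at the
     points with smaller index. *)
  apply: (@triangular_leq R n d.+1 (fun i => phi (d - i)%N) (fun i => y (d - i)%N)).
    move=> i j ij; have jd : (j <= d)%N by rewrite -ltnS.
    have -> : (d - i = (d - i).-1.+1)%N by lia.
    have [Fy _] := Hy (d - j)%N (leq_subr _ _).
    rewrite phiE; last exact: FP Fy.
    have := @F_mono (d - j)%N (d - i).-1 _ _ Fy; rewrite (Hab _).2 => -[|_ ->].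
      by lia.
    by rewrite subrr.
  move=> i; have := Hy (d - i)%N (leq_subr _ _); case: (d - i)%N => [|k] [Fy nFy].
    by rewrite /= Pu //; apply: FP Fy.
  rewrite phiE; last exact: FP Fy.
  apply/eqP => /subr0_eq E; apply: nFy; rewrite (Hab k).2.
  by split=> //; apply: FP Fy.
apply: (@leq_trans (2 ^ d)); last by rewrite leq_exp2l //; lia.
(* For two points of the sphere, the pairing is at most [rho], with equality only when they
   coincide. *)
pose F i := [set x | P x /\ dotmx (pt i) x = rho].
have F_face i : faces P (F i).
  apply/faceP; exists (pt i), rho; split=> //; apply: dotmx_conv_le => _ [j _ <-].
  have := dotmx_ge0 (pt i - pt j); rewrite dotmx_sqrB !Hr; lra.
have F_pt i : F i `<=` [set pt i].
  apply: (face_sub (F_face i)) => [x y t _ -> ->|_ [j _ <-] [_ E]].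
    by rewrite /= -scalerDl addrCA subrr addr0 scale1r.
  apply/eqP; rewrite -subr_eq0 -dotmx_eq0 dotmx_sqrB !Hr dotmxC E.
  by apply/eqP; ring.
have F_i i : F i (pt i).
  by split; [apply: sub_conv_hull; exists i | rewrite Hr].
have /choice [A HA] : forall i, exists A, g (F i) A by move=> i; apply: g_neq0 (F_i i).
suff A_inj : injective A.
  by have := leq_card A A_inj; rewrite card_ffun card_bool card_ord.
(* A common corner would come from a nonempty face contained in both singletons. *)
move=> i j E; apply/pt_inj; apply: contrapT => nij.
have [|G HG gG] := g_surj [set A i].
  right; exists (A i), finset.set0; apply/seteqP; split=> [B -> //|B H].
  by apply/ffunP => m; apply: H; rewrite inE.
have Gi : G `<=` F i by apply/g_sub => //; rewrite gG => _ ->.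
have Gj : G `<=` F j by apply/g_sub => //; rewrite gG => _ ->; rewrite E.
have : G `<=` set0.
  move=> x Gx; apply: nij; have Ei : x = pt i := F_pt _ _ (Gi _ Gx).
  by rewrite -Ei; exact: (F_pt _ _ (Gj _ Gx)).
move/(g_sub _ _ HG (face_set0 P)); rewrite g0 gG; exact.
Qed.

End CubePolytopes.

(** * Permutations and their words *)

Section Words.
Variable n : nat.
Implicit Types u v w z : 'S_n.

Definition word z : seq nat := [seq (z i).+1 | i <- enum 'I_n].

Lemma size_word z : size (word z) = n.
Proof. by rewrite size_map size_enum_ord. Qed.

Lemma nth_word z (i : 'I_n) : nth 0 (word z) i = (z i).+1.
Proof. by rewrite (nth_map i) ?size_enum_ord // nth_ord_enum. Qed.

Lemma onelineE_nth z p : oneline z p.+1 = nth 0 (word z) p.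
Proof.
have [Hp|Hp] := ltnP p n; first by rewrite (onelineE z (Ordinal Hp)) -nth_word.
by rewrite nth_default ?size_word // /oneline insubN // -leqNgt.
Qed.

Lemma word_inj : injective word.
Proof.
move=> u z E; apply/permP => i; apply: val_inj; apply: succn_inj.
by rewrite -!nth_word E.
Qed.

Lemma perm_word z : perm_eq (word z) (iota 1 n).
Proof.
apply: uniq_perm; rewrite ?iota_uniq //.
  by rewrite map_inj_uniq ?enum_uniq // => i j [] /val_inj /perm_inj.
move=> k; rewrite mem_iota add1n ltnS; apply/mapP/andP => [[i _ ->] //|[k0 kn]].
have Hk : k.-1 < n by rewrite prednK.
by exists (z^-1 (Ordinal Hk))%g; rewrite ?mem_enum // permKV /= prednK.
Qed.

Lemma perm_word2 u z : perm_eq (word u) (word z).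
Proof. by rewrite (permPl (perm_word u)) perm_sym perm_word. Qed.

Lemma uniq_word z : uniq (word z).
Proof. by rewrite (perm_uniq (perm_word z)) iota_uniq. Qed.

Lemma word_surj s z : perm_eq s (word z) -> exists u, word u = s.
Proof.
move=> H; have Hs : size s = n by rewrite (perm_size H) size_word.
have Us : uniq s by rewrite (perm_uniq H) uniq_word.
have Hi (i : 'I_n) : (nth 0 s i).-1 < n /\ 0 < nth 0 s i.
  have : nth 0 s i \in iota 1 n.
    by rewrite -(perm_mem (perm_trans H (perm_word z))) mem_nth ?Hs.
  by rewrite mem_iota add1n ltnS => /andP[h0 h]; rewrite prednK.
pose f i := Ordinal (proj1 (Hi i)).
have f_inj : injective f.
  move=> i j /(congr1 val) /= E; apply: val_inj; apply/eqP.
  have [_ hi] := Hi i; have [_ hj] := Hi j.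
  by rewrite -(nth_uniq 0 _ _ Us) ?Hs ?ltn_ord // -(prednK hi) E prednK.
exists (perm f_inj); apply: (@eq_from_nth _ 0); first by rewrite size_word Hs.
rewrite size_word => i Hin; rewrite (nth_word _ (Ordinal Hin)) permE /=.
by have [_ hi] := Hi (Ordinal Hin); rewrite prednK.
Qed.

End Words.

(** * From word intervals to polytopes *)

Section PermutationPolytopes.
Variable R : realType.
Local Open Scope classical_set_scope.
Local Open Scope ring_scope.

Lemma linvalE (f : nat -> R) s : linval f s = \sum_(0 <= i < size s) f i * (nth 0%N s i)%:R.
Proof.
elim: s f => [|x s IH] f; first by rewrite big_geq.
by rewrite /= IH big_nat_recl.
Qed.

Lemma linval_word n (f : nat -> R) (z : 'S_n) :
  linval f (word z) = dotmx (\row_i f i) (perm_point R z).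
Proof.
rewrite linvalE size_word big_mkord; apply: eq_bigr => i _.
by rewrite !mxE nth_word.
Qed.

Section FixedDegree.
Variables (n : nat) (v w : 'S_n).
Hypothesis n_gt0 : (0 < n)%N.
Hypothesis itvE : forall z, (z \in bruhat_itv v w) <-> itv (word v) (word w) (word z).

Let u : 'rV[R]_n := const_mx 1.
Let kappa : R := \sum_(i < n) (i.+1)%:R.

Let kappa_neq0 : kappa != 0.
Proof.
rewrite /kappa; case: (n) n_gt0 => // m _.
by rewrite -natr_sum pnatr_eq0 sum_nat_eq0; apply/forallPn; exists ord0.
Qed.

Let dot_u (z : 'S_n) : dotmx u (perm_point R z) = kappa.
Proof.
rewrite /kappa (reindex_inj (@perm_inj _ z)); apply: eq_bigr => i _.
by rewrite !mxE mul1r.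
Qed.

Let V := [set perm_point R z | z in [set` bruhat_itv v w]].

Lemma perm_point_inj : injective (@perm_point R n).
Proof.
move=> y z E; apply/permP => i; apply: val_inj; apply: succn_inj; apply/eqP.
by have /rowP /(_ i) := E; rewrite !mxE => /eqP; rewrite eqr_nat.
Qed.

Lemma atleast_not_cube :
  atleast (itv (word v) (word w)) (2 ^ n.-1).+1 -> ~ comb_cube (bruhat_polytope R v w).
Proof.
move=> [l [lu ls lE]]; rewrite /bruhat_polytope => HC.
pose I := {z : 'S_n | z \in bruhat_itv v w}.
have HV : V = range (fun z : I => perm_point R (val z)).
  apply/seteqP; split=> [_ [z Hz <-]|_ [[z Hz] _ <-]]; last by exists z.
  by exists (exist _ z Hz).
have pt_inj : injective (fun z : I => perm_point R (val z)).
  by move=> y z /perm_point_inj /val_inj.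
pose rho : R := \sum_(i < n) ((i.+1)%:R * (i.+1)%:R).
have Hrho (z : I) : dotmx (perm_point R (val z)) (perm_point R (val z)) = rho.
  rewrite /rho (reindex_inj (@perm_inj _ (val z))); apply: eq_bigr => i _.
  by rewrite !mxE.
have := comb_cube_card pt_inj kappa_neq0 (fun z => dot_u (val z)) Hrho.
rewrite -HV => /(_ HC); rewrite card_sig => Hc.
have : (size l <= #|bruhat_itv v w|)%N.
  rewrite cardE -(size_map (@word n)); apply: uniq_leq_size => // s /lE Hs.
  have [Hp _ _] := Hs; have [z Ez] := word_surj Hp.
  by rewrite -Ez map_f // mem_enum; apply/itvE; rewrite Ez.
by move=> H; have := leq_trans ls (leq_trans H Hc); rewrite ltnn.
Qed.

Lemma cubical_comb_cube :
  cubical R (itv (word v) (word w)) n.-1 -> comb_cube (bruhat_polytope R v w).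
Proof.
move=> [F [F1 F2]]; exists n.-1; apply: (@cube_like_equiv R _ _ n.-1); last exact: cube_like_unit.
pose alpha (m : 'I_n.-1) b : 'rV[R]_n := \row_i (F m b).1 i.
pose beta (m : 'I_n.-1) b : R := (F m b).2.
have affE m b z : affmx alpha beta m b (perm_point R z) = affval (F m b) (word z).
  by rewrite /affval linval_word.
have pat (z : 'S_n) (A : nat -> bool) (B : {ffun 'I_n.-1 -> bool}) : (forall m, B m = A m) -> pattern F n.-1 (word z) A ->
    patternmx alpha beta (perm_point R z) B.
  by move=> BA PA m b; rewrite affE BA; apply: PA.
have V_pat (B : {ffun 'I_n.-1 -> bool}) : exists2 x, V x & patternmx alpha beta x B.
  have [s Es Ps] := F2 (fun m => oapp B true (insub m)).
  have [Hp _ _] := Es; have [z Ez] := word_surj Hp; rewrite -Ez in Es Ps.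
  exists (perm_point R z); first by exists z => //; apply/itvE.
  by apply: pat Ps => m; rewrite valK.
apply: (@cube_recognition R n n.-1 V u kappa alpha beta) => //.
- by move=> _ [z _ <-]; apply: dot_u.
- move=> _ [z /itvE /F1 [A PA] <-].
  by exists [ffun m : 'I_n.-1 => A m]; apply: pat PA => m; rewrite ffunE.
move=> A y uy ay; apply/eqP; apply: contraT => y0; exfalso.
have /choice [p Hp] := fun B => (let: ex_intro2 x Vx Px := V_pat B in
  ex_intro (fun x => V x /\ patternmx alpha beta x B) x (conj Vx Px)).
pose flip (m : 'I_n.-1) : {ffun 'I_n.-1 -> bool} := [ffun i => if i == m then ~~ A i else A i].
(* A nonzero [y] killed by all these functionals would extend the triangular system: [u], the n - 1
   functionals vanishing at [p A], and [y], against [p A], the n - 1 differences to its neighbours,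
   and [y]. These are n + 1 rows in dimension n. *)
pose x (j : nat) := if j is j'.+1 then
  if insub j' is Some m then p (flip m) - p A else y else p A.
pose phi (j : nat) := if j is j'.+1 then
  if insub j' is Some m then alpha m (A m) else y else u.
have Vu B : dotmx u (p B) = kappa by have [[z _ <-] _] := Hp B; apply: dot_u.
have alphaE m k : dotmx (alpha m (A m)) (p (flip k) - p A) =
    affmx alpha beta m (A m) (p (flip k)).
  have := (Hp A).2 m (A m); rewrite eqxx /affmx linearB /= => h.
  by rewrite -[RHS]subr0 -h; ring.
suff : (n.+1 <= n)%N by rewrite ltnn.
apply: (@triangular_leq R n n.+1 (fun i => phi i) (fun i => x i)).
  move=> [[|i] Hi] [[|j] Hj] //= ij.
    by case: insubP => [k _ _|_] //; rewrite linearB /= !Vu subrr.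
  have Hi' : (i < n.-1)%N by lia.
  rewrite insubT /=; case: insubP => [k _ Ek|_]; last exact: ay.
  rewrite alphaE; have := (Hp (flip k)).2 (Sub i Hi') (A (Sub i Hi')); rewrite ffunE.
  case: (eqVneq (Sub i Hi') k) => [E|_]; last by rewrite eqxx.
  by move: ij; rewrite -Ek -E /= ltnn.
move=> [[|i] Hi] /=; first by rewrite Vu.
case: insubP => [k _ Ek|_]; last by rewrite dotmx_eq0.
rewrite alphaE; have := (Hp (flip k)).2 k (A k); rewrite ffunE eqxx.
by case: (A k) => /= h; rewrite gt_eqF.
Qed.

End FixedDegree.
End PermutationPolytopes.

(** * Length as the number of inversions *)

Section Inversions.
Variable n : nat.
Implicit Types u v w z : 'S_n.

Definition inv z : nat := \sum_(p < n) \sum_(q < n) ((p < q) && (z q < z p)).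

Definition between u (a b : 'I_n) := [set p : 'I_n | (a < p < b) && (u b < u p < u a)].

Lemma sum_split2 (a b : 'I_n) (f : 'I_n -> nat) : a != b ->
  \sum_q f q = f a + f b + \sum_(q | (q != a) && (q != b)) f q.
Proof.
move=> ab; rewrite (bigD1 a) //= (bigD1 b) /=; last by rewrite eq_sym.
by rewrite addnA.
Qed.

Lemma sum_split4 (a b : 'I_n) (f : 'I_n -> 'I_n -> nat) : a != b ->
  \sum_p \sum_q f p q = f a a + f a b + f b a + f b b
   + \sum_(q | (q != a) && (q != b)) (f a q + f b q + f q a + f q b)
   + \sum_(p | (p != a) && (p != b)) \sum_(q | (q != a) && (q != b)) f p q.
Proof.
move=> ab; rewrite (sum_split2 _ ab) (sum_split2 (f a) ab) (sum_split2 (f b) ab).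
have -> : \sum_(p | (p != a) && (p != b)) \sum_q f p q =
    \sum_(p | (p != a) && (p != b)) (f p a + f p b + \sum_(q | (q != a) && (q != b)) f p q).
  by apply: eq_bigr => p _; rewrite (sum_split2 _ ab).
rewrite !big_split /=; lia.
Qed.

(** Pairs avoiding [a] and [b] are unaffected. A third place contributes through its pairs with [a]
    and [b], and their total changes only if it lies between them in place and in value; both pairs
    are then lost. *)
Lemma inv_tperm u (a b : 'I_n) : a < b -> u b < u a ->
  inv u = (inv (u \oS tperm a b) + #|between u a b|.*2).+1.
Proof.
move=> ab uba; pose t := tperm a b.
have nab : a != b by rewrite neq_ltn ab.
have tK : involutive t by apply: tpermK.
have Einv : inv (u \oS t) = \sum_(p < n) \sum_(q < n) ((t p < t q) && (u q < u p)).
  rewrite /inv (reindex_inj (@perm_inj _ t)); apply: eq_bigr => p _.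
  rewrite (reindex_inj (@perm_inj _ t)); apply: eq_bigr => q _.
  by rewrite !permcompE !tK.
have tN q : (q != a) && (q != b) -> t q = q.
  by move=> /andP[qa qb]; rewrite /t tpermD // eq_sym.
have ta : t a = b by apply: tpermL.
have tb : t b = a by apply: tpermR.
have Ecard : #|between u a b| =
    \sum_(q | (q != a) && (q != b)) ((a < q < b) && (u b < u q < u a)).
  rewrite -sum1_card big_mkcond /= (sum_split2 _ nab) !inE !ltnn /= andbF /= !add0n.
  by apply: eq_bigr => q _; rewrite inE; case: ifP.
rewrite Einv /inv !(sum_split4 _ nab) Ecard -mul2n big_distrr /= !ta !tb.
rewrite !ltnn ab uba [b < a]ltnNge [u a < u b]ltnNge (ltnW ab) (ltnW uba) /=.
set A := \sum_(p | _) \sum_(q | _) _; set B := \sum_(p | _) \sum_(q | _) _.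
have -> : A = B.
  by apply: eq_bigr => p Hp; apply: eq_bigr => q Hq; rewrite !tN.
set C := \sum_(q | _) _; set D := \sum_(q | _) _; set K := \sum_(q | _) _.
suff -> : C = D + K by lia.
rewrite -big_split; apply: eq_bigr => q Hq /=; rewrite !tN //.
have /andP[qa qb] := Hq.
have : u q != u a :> nat by rewrite val_eqE (inj_eq perm_inj).
have : u q != u b :> nat by rewrite val_eqE (inj_eq perm_inj).
move: qa qb; rewrite -!val_eqE /=; lia.
Qed.

Lemma permcomp_tpermK u (a b : 'I_n) : (u \oS tperm a b) \oS tperm a b = u.
Proof. by apply/permP => i; rewrite !permcompE tpermK. Qed.

Lemma inv_tperm_lt u (a b : 'I_n) : a < b ->
  (inv u < inv (u \oS tperm a b)) = (u a < u b).
Proof.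
move=> ab; have [uab|uba|/val_inj/perm_inj E] := ltngtP (u a) (u b); last first.
- by rewrite E ltnn in ab.
- by rewrite (inv_tperm ab uba); lia.
have := @inv_tperm (u \oS tperm a b) a b ab; rewrite permcomp_tpermK !permcompE.
by rewrite tpermL tpermR => /(_ uab); lia.
Qed.

Lemma between_adjacent u (a b : 'I_n) : b = a.+1 :> nat -> between u a b = finset.set0.
Proof. by move=> E; apply/setP => p; rewrite !inE E; lia. Qed.

Lemma word_prod_rcons (e : seq 'I_n.-1) m :
  word_prod (rcons e m) = word_prod e \oS stransp n m.+1.
Proof.
rewrite -cats1 word_prod_cat; congr permcomp.
by rewrite /word_prod big_cons big_nil /permcomp mul1g.
Qed.

Lemma stranspE (m : nat) (a b : 'I_n) : a = m :> nat -> b = m.+1 :> nat ->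
  stransp n m.+1 = tperm a b.
Proof. by move=> Ea Eb; rewrite /stransp -{1}Ea -Eb transpE. Qed.

Lemma inv_stransp u (m : nat) (a b : 'I_n) : a = m :> nat -> b = m.+1 :> nat ->
  if u a < u b then inv (u \oS stransp n m.+1) = (inv u).+1
  else inv u = (inv (u \oS stransp n m.+1)).+1.
Proof.
move=> Ea Eb; rewrite (stranspE Ea Eb).
have ab : a < b by rewrite Ea Eb.
have Eab : b = a.+1 :> nat by rewrite Ea Eb.
case: ltngtP => [uab|uba|/val_inj/perm_inj E]; last by rewrite E ltnn in ab.
  have := @inv_tperm (u \oS tperm a b) a b ab; rewrite permcomp_tpermK !permcompE.
  by rewrite tpermL tpermR between_adjacent // cards0 addn0; apply.
by rewrite (inv_tperm ab uba) between_adjacent // cards0 addn0.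
Qed.

Lemma sorted_enum_ord : sorted (fun i j : 'I_n => i < j) (enum 'I_n).
Proof.
by have := iota_ltn_sorted 0 n; rewrite -val_enum_ord sorted_map.
Qed.

Lemma no_descent_id u :
  (forall a b : 'I_n, b = a.+1 :> nat -> u a < u b) -> u = 1%g.
Proof.
move=> H; have mono d : forall a b : 'I_n, b = a + d.+1 :> nat -> u a < u b.
  elim: d => [|d IH] a b E; first by apply: H; rewrite E addn1.
  have Hc : a + d.+1 < n by have := ltn_ord b; lia.
  have Eb : b = (Ordinal Hc).+1 :> nat by rewrite /= E !addnS.
  exact: ltn_trans (IH a (Ordinal Hc) erefl) (H _ _ Eb).
apply: word_inj; apply: (irr_sorted_eq ltn_trans ltnn).
- apply: homo_sorted sorted_enum_ord => a b ab; rewrite ltnS.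
  by apply: (mono (b - a).-1); lia.
- by apply: homo_sorted sorted_enum_ord => a b ab; rewrite !perm1.
exact: (perm_mem (perm_word2 _ _)).
Qed.

Lemma inv1 : inv 1%g = 0.
Proof.
apply: big1 => p _; apply: big1 => q _; rewrite !perm1; lia.
Qed.

Lemma letterP (m : 'I_n.-1) : exists a b : 'I_n, a = m :> nat /\ b = m.+1 :> nat.
Proof.
have Hb : m.+1 < n by have := ltn_ord m; lia.
by exists (Ordinal (ltnW Hb)), (Ordinal Hb).
Qed.

Lemma inv_word_prod e : inv (word_prod e : 'S_n) <= size e.
Proof.
elim/last_ind: e => [|e m IH]; first by rewrite /word_prod big_nil inv1.
have [a [b [Ea Eb]]] := letterP m.
rewrite word_prod_rcons size_rcons; have := inv_stransp (word_prod e) Ea Eb.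
by case: ifP => _; lia.
Qed.

Lemma reduced_word u : exists2 e : seq 'I_n.-1, word_prod e = u & size e = inv u.
Proof.
move: {2}(inv u) (erefl (inv u)) => k; elim: k u => [|k IH] u Hk.
  exists [::] => //.
  rewrite /word_prod big_nil; apply/esym/no_descent_id => a b E.
  have := inv_stransp u erefl E; rewrite Hk; case: ltnP => // _; lia.
have [[a [b [E Hd]]]|H] := pselect (exists a b : 'I_n, b = a.+1 :> nat /\ u b < u a).
  have Hm : a < n.-1 by have := ltn_ord b; lia.
  have := inv_stransp u erefl E; rewrite ltnNge (ltnW Hd) /= Hk => -[Hk'].
  have [e He Hs] := IH _ (esym Hk'); exists (rcons e (Ordinal Hm)).
    rewrite word_prod_rcons He /= (stranspE (erefl (a : nat)) E).
    by rewrite permcomp_tpermK.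
  by rewrite size_rcons; lia.
have u1 : u = 1%g.
  apply: no_descent_id => a b E; rewrite ltnNge; apply/negP => Hba; apply: H.
  exists a, b; split=> //; rewrite ltn_neqAle Hba andbT.
  by apply: contra_eq_neq E => /val_inj/perm_inj ->; rewrite neq_ltn ltnSn.
by rewrite u1 inv1 in Hk.
Qed.

Lemma lenE u : len u = inv u.
Proof.
rewrite /len; case: ex_minnP => l /existsP[e /eqP He] Hmin.
apply/eqP; rewrite eqn_leq; apply/andP; split.
  have [e' He' <-] := reduced_word u; apply: Hmin.
  by apply/existsP; exists (in_tuple e'); rewrite /= He'.
by have := inv_word_prod e; rewrite He size_tuple.
Qed.

End Inversions.

(** * The rank criterion for the Bruhat order *)

Section BruhatOrder.
Variable n : nat.
Implicit Types u v w z : 'S_n.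

Lemma word_tperm u (a b : 'I_n) : a < b -> exists s t r,
  [/\ word u = s ++ (u a).+1 :: t ++ (u b).+1 :: r,
      word (u \oS tperm a b) = s ++ (u b).+1 :: t ++ (u a).+1 :: r,
      size s = a & size t = b - a.+1].
Proof.
move=> ab; pose e := enum 'I_n.
have Ee : e = take a e ++ a :: take (b - a.+1) (drop a.+1 e) ++ b :: drop b.+1 e.
  rewrite -{1}(cat_take_drop a e) (drop_nth a) ?size_enum_ord ?ltn_ord //.
  rewrite nth_ord_enum; congr (_ ++ _ :: _).
  rewrite -{1}(cat_take_drop (b - a.+1) (drop a.+1 e)) drop_drop subnK //.
  by rewrite [drop b e](drop_nth b) ?size_enum_ord ?ltn_ord // nth_ord_enum.
have Hs : size (take a e) = a by rewrite size_takel // size_enum_ord ltnW.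
have Ht : size (take (b - a.+1) (drop a.+1 e)) = b - a.+1.
  by rewrite size_takel // size_drop size_enum_ord leq_sub2r // ltnW.
move: (take a e) (take (b - a.+1) _) (drop b.+1 e) Hs Ht Ee => s t r Hs Ht Ee.
exists [seq (u i).+1 | i <- s], [seq (u i).+1 | i <- t], [seq (u i).+1 | i <- r].
rewrite !size_map Hs Ht; split=> //; first by rewrite /word -/e Ee map_cat /= map_cat.
have : uniq (a :: b :: s ++ t ++ r).
  rewrite -(perm_uniq (_ : perm_eq e _)) ?enum_uniq // Ee; apply/seq.permP => p.
  rewrite /= !count_cat /= !count_cat /=; lia.
rewrite /= inE negb_or !mem_cat !negb_or.
case/and3P=> /andP[_ /and3P[as_ at_ ar]] /and3P[bs bt br] _.
rewrite /word -/e Ee map_cat /= map_cat /= !permcompE tpermL tpermR.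
have Hmap l : a \notin l -> b \notin l ->
    [seq ((u \oS tperm a b) i).+1 | i <- l] = [seq (u i).+1 | i <- l].
  move=> al bl; apply/eq_in_map => i il; rewrite permcompE tpermD //.
    by apply: contraNneq al => ->.
  by apply: contraNneq bl => ->.
by rewrite !Hmap.
Qed.

Lemma dom_tperm u (a b : 'I_n) : a < b -> u a < u b ->
  dom (word u) (word (u \oS tperm a b)).
Proof.
move=> ab uab; have [s [t [r [-> -> _ _]]]] := word_tperm u ab.
by apply: dom_swap; rewrite ltnS ltnW.
Qed.

Lemma rank_word u a h : rank (word u) a h = \sum_(p < n) ((p < a) && (h <= (u p).+1)).
Proof.
have -> : rank (word u) a h = \sum_(0 <= p < n) ((p < a) && (h <= nth 0 (word u) p)).
  rewrite -{2}(size_word u); elim: a => [|a IH].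
    by rewrite rank0 big1.
  rewrite rankS IH.
  rewrite [RHS](eq_bigr (fun p => ((p < a) && (h <= nth 0 (word u) p)) +
     ((p == a) && (h <= nth 0 (word u) p)))); last first.
    by move=> p _; rewrite ltnS leq_eqVlt; case: ltngtP => //= _; rewrite ?addn0.
  rewrite big_split /=; congr addn.
  case: (ltnP a (size (word u))) => Ha /=.
    rewrite (bigD1_seq a) ?iota_uniq ?mem_index_iota //= eqxx big1 ?addn0 // => p.
    by move=> /negbTE ->.
  rewrite big_nat big1 // => p /andP[_ Hp]; rewrite ltn_eqF //.
  exact: leq_trans Hp Ha.
by rewrite big_mkord; apply: eq_bigr => p _; rewrite nth_word.
Qed.

Lemma bruhat_len u z : bruhat u z -> u = z \/ len u < len z.
Proof.
move/connectP => [p]; elim: p u => [|x p IH] u /=; first by move=> _ ->; left.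
move=> /andP[/andP[_ ux] px] Ez; right.
by have [<-|xz] := IH _ px Ez; [|apply: ltn_trans xz].
Qed.

Lemma bruhat_tperm u (a b : 'I_n) : a < b -> u a < u b -> bruhat u (u \oS tperm a b).
Proof.
move=> ab uab; apply: connect1; rewrite /bruhat_step !lenE inv_tperm_lt // uab andbT.
by apply/existsP; exists a; apply/existsP; exists b.
Qed.

Lemma bruhat_dom u z : bruhat u z -> dom (word u) (word z).
Proof.
move/connectP => [p]; elim: p u => [|x p IH] u /=.
  by move=> _ ->; apply: domxx.
move=> /andP[/andP[/existsP[a /existsP[b /eqP Ex]] ux] px] Ez.
apply: dom_trans (IH _ px Ez); rewrite !lenE in ux.
have [ab|ba|/val_inj E] := ltngtP a b.
- by rewrite Ex; apply: dom_tperm => //; rewrite -inv_tperm_lt // -Ex.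
- rewrite Ex tpermC in ux *; apply: dom_tperm => //.
  by rewrite -inv_tperm_lt.
by rewrite Ex E tperm1 /permcomp mul1g ltnn in ux.
Qed.

Lemma inv_bound u : inv u <= n * n.
Proof.
rewrite /inv; apply: (@leq_trans (\sum_(p < n) \sum_(q < n) 1)).
  by apply: leq_sum => p _; apply: leq_sum => q _; case: (_ && _).
by rewrite !sum_nat_const card_ord muln1.
Qed.

(* The exchange below goes up to the smallest entry that lies above u(i) and
   does not exceed z(i), i being the first position where u and z differ; the
   ranks of the result are still bounded by those of z. *)
Lemma dom_step u z : dom (word u) (word z) -> u != z ->
  exists a b : 'I_n, [/\ a < b, u a < u b & dom (word (u \oS tperm a b)) (word z)].
Proof.
move=> H uz.
have [i0 Hi0] : exists i, u i != z i.
  apply/existsP; rewrite -negb_forall; apply: contra uz => /forallP E.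
  by apply/eqP/permP => i; apply/eqP.
case: (@arg_minnP _ i0 (fun i => u i != z i) (fun i : 'I_n => i : nat) Hi0) => i Hi Hmin.
have Heq (p : 'I_n) : p < i -> u p = z p.
  by move=> pi; apply/eqP; apply: contraTT pi => /Hmin; rewrite -leqNgt.
have uzi : u i < z i.
  rewrite ltn_neqAle Hi /=; have := H i.+1 (u i).+1.
  rewrite !rankS !size_word ltn_ord !nth_word leqnn /=.
  have -> : rank (word u) i (u i).+1 = rank (word z) i (u i).+1.
    rewrite !rank_word; apply: eq_bigr => p _.
    by case: (ltnP p i) => //= pi; rewrite (Heq p pi).
  by rewrite leq_add2l lt0b ltnS.
pose Pj (j : 'I_n) := (i < j) && (u i < u j <= z i).
have Hj0 : Pj (u^-1 (z i))%g.
  rewrite /Pj permKV uzi leqnn !andbT ltn_neqAle; apply/andP; split.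
    by apply: contra_neq Hi => /val_inj E; rewrite {1}E permKV.
  rewrite leqNgt; apply/negP => h; have := Heq _ h; rewrite permKV => /perm_inj E.
  by rewrite -E ltnn in h.
case: (@arg_minnP _ _ Pj (fun j : 'I_n => j : nat) Hj0) => j /andP[ij /andP[uij ujz]] Hjmin.
exists i, j; split=> // a h.
have [s [t [r [Eu Eut Hs Ht]]]] := word_tperm u ij.
have := H a h; rewrite Eu Eut !rank_cat => Hah.
(* Only for these cuts and thresholds does the exchange raise a rank, and then by one, so a strict
   inequality is needed there. *)
have [Hcond|Hcond] := boolP ((i < a <= j) && ((u i).+1 < h <= (u j).+1)); last first.
  apply: leq_trans Hah; rewrite leq_add2l.
  case E: (a - size s) => [|e]; rewrite ?rank0 // !rank_cons !rank_cat.
  case E2: (e - size t) => [|e']; rewrite ?rank0 ?rank_cons; last lia.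
  move: Hcond; rewrite Hs in E; rewrite Ht in E2; lia.
have /andP[/andP[ia aj] /andP[uih huj]] := Hcond.
(* Compare with threshold [(z i).+2], which counts the values above [z i]. By minimality of [j], no
   place strictly between [i] and [a] has a value of [u] above [u i] and at most [z i], while [z]
   gains [z i] itself. *)
have Hlt : rank (word u) a h < rank (word z) a h.
  have H1 := H a (z i).+2; rewrite -(ltn_add2r (rank (word z) a (z i).+2)).
  apply: (@leq_trans (rank (word z) a h + rank (word u) a (z i).+2)); last first.
    by rewrite leq_add2l.
  rewrite !rank_word -!big_split /= (bigD1 i) //= [X in _ < X](bigD1 i) //= ia /=.
  rewrite -addSn; apply: leq_add; first by lia.
  apply: leq_sum => p pi; have [pa|//] := ltnP p a; rewrite /=.
  have [pi'|ip] := ltnP p i; first by rewrite (Heq p pi'); lia.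
  have ip' : i < p by rewrite ltn_neqAle eq_sym -val_eqE in pi *; rewrite pi.
  have : ~~ Pj p.
    apply/negP => /Hjmin; lia.
  rewrite /Pj ip' /=; lia.
apply: leq_trans Hlt; rewrite Eu !rank_cat -addnS leq_add2l.
case E: (a - size s) => [|e]; rewrite ?rank0 // !rank_cons !rank_cat.
have -> : e - size t = 0 by rewrite Ht; rewrite Hs in E; lia.
rewrite !rank0; lia.
Qed.

Lemma dom_bruhat u z : dom (word u) (word z) -> bruhat u z.
Proof.
move: {2}(n * n - inv u) (leqnn (n * n - inv u)) => k.
elim: k u => [|k IH] u Hk H; have [->|uz] := eqVneq u z; try exact: connect0;
  have [a [b [ab uab Hd]]] := dom_step H uz;
  have := inv_tperm_lt u ab; rewrite uab; have := inv_bound (u \oS tperm a b) => h1 h2.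
  lia.
apply: connect_trans (bruhat_tperm ab uab) _; apply: IH => //; lia.
Qed.

Lemma bruhatP u z : bruhat u z <-> dom (word u) (word z).
Proof. by split; [apply: bruhat_dom | apply: dom_bruhat]. Qed.

Lemma bruhat_itvE v w z :
  (z \in bruhat_itv v w) <-> itv (word v) (word w) (word z).
Proof.
rewrite inE; split=> [/andP[/bruhatP H1 /bruhatP H2]|[_ /bruhatP -> /bruhatP ->]] //.
by split=> //; apply: perm_word2.
Qed.

(** A difference of one in length leaves no room between [z] and [w], so only the lower bound
    remains to be tested. *)
Lemma coatomE v w z : bruhat v w -> len w = (len z).+1 -> bruhat z w ->
  coatom v w z <-> dom (word v) (word z).
Proof.
move=> vw Hl zw; rewrite /coatom inE zw andbT; split.
  by case/andP=> /bruhatP.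
move=> /bruhatP ->; rewrite /bruhat_cover zw /=; apply/andP; split.
  by apply/eqP => E; move: Hl; rewrite E; lia.
apply/forallP => x; apply/implyP => /andP[/bruhat_len [->|zx] /bruhat_len [->|xw]];
  rewrite ?eqxx ?orbT //; lia.
Qed.

End BruhatOrder.

(** * Runs of simple transpositions and the shape of the two words *)

Section RotatedPair.
Variable n : nat.
Implicit Types u v w : 'S_n.

Lemma permcompA u v w : u \oS (v \oS w) = (u \oS v) \oS w.
Proof. by rewrite /permcomp mulgA. Qed.

Lemma oneline_gt u p : n < p -> oneline u p = 0.
Proof.
by case: p => // p np; rewrite onelineE_nth nth_default // size_word.
Qed.

Lemma oneline_stransp u b p : 0 < b < n -> 0 < p ->
  oneline (u \oS stransp n b) p =
  oneline u (if p == b then b.+1 else if p == b.+1 then b else p).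
Proof.
case: b => // b /andP[_ bn]; case: p => // p _.
have [pn|np] := ltnP p n; last first.
  by rewrite !oneline_gt //; do 2?case: eqP; lia.
pose a := Ordinal (ltnW bn); pose b' := Ordinal bn.
rewrite (@stranspE _ b a b') // (onelineE _ (Ordinal pn)) permcompE.
have [pb|pb] := eqVneq p b.
  have -> : Ordinal pn = a by apply: val_inj.
  by rewrite tpermL pb eqxx (onelineE _ b').
have [pb1|pb1] := eqVneq p b.+1.
  have -> : Ordinal pn = b' by apply: val_inj.
  by rewrite tpermR pb1 !eqSS gtn_eqF // eqxx (onelineE _ a).
rewrite !eqSS (negbTE pb) (negbTE pb1) tpermD ?(onelineE _ (Ordinal pn)) //.
  by rewrite -val_eqE eq_sym.
by rewrite -val_eqE eq_sym.
Qed.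

Lemma inv_stransp_oneline u b : 0 < b < n ->
  if oneline u b < oneline u b.+1 then inv (u \oS stransp n b) = (inv u).+1
  else inv u = (inv (u \oS stransp n b)).+1.
Proof.
case: b => // b /andP[_ bn].
have := @inv_stransp _ u b (Ordinal (ltnW bn)) (Ordinal bn) erefl erefl.
by rewrite (onelineE _ (Ordinal (ltnW bn))) (onelineE _ (Ordinal bn)) ltnS.
Qed.

Lemma stransp_run_id a : stransp_run n a a = 1%g.
Proof. by rewrite /stransp_run big_geq. Qed.

Lemma stransp_runS a b : a <= b ->
  stransp_run n a b.+1 = stransp_run n a b \oS stransp n b.
Proof.
move=> ab; rewrite /stransp_run /index_iota subSn // -addn1 iotaD subnKC //=.
elim: (iota a (b - a)) => [|m s IH] /=; last by rewrite !big_cons IH permcompA.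
by rewrite !big_cons big_nil /permcomp mulg1 mul1g.
Qed.

Lemma permcomp1 u : u \oS 1%g = u.
Proof. by rewrite /permcomp mul1g. Qed.

Lemma oneline_run u a b p : 0 < a <= b -> b <= n -> 0 < p ->
  oneline (u \oS stransp_run n a b) p =
  oneline u (if p == b then a else if a <= p < b then p.+1 else p).
Proof.
move=> /andP[a0 ab]; elim: b ab p => [|b IH]; first by lia.
rewrite leq_eqVlt => /predU1P[<-|ab] p bn p0.
  rewrite stransp_run_id permcomp1; case: eqP => [->|_] //.
  by case: ifP => //; lia.
rewrite stransp_runS // permcompA oneline_stransp //; last by lia.
rewrite IH //; [|lia|by do 2?case: ifP; lia].
congr oneline; do 6?case: ifP; lia.
Qed.

Lemma inv_run_leq u a b : 0 < a <= b -> b <= n ->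
  inv (u \oS stransp_run n a b) <= inv u + (b - a).
Proof.
move=> /andP[a0 ab]; elim: b ab => [|b IH]; first by lia.
rewrite leq_eqVlt => /predU1P[<-|ab] bn.
  by rewrite stransp_run_id permcomp1 leq_addr.
rewrite stransp_runS // permcompA subSn // addnS.
have Hb : 0 < b < n by lia.
have := inv_stransp_oneline (u \oS stransp_run n a b) Hb.
have := IH ab (ltnW bn); case: ifP; lia.
Qed.

(** Each letter of the run adds at most one inversion, so all of them must be ascents. The letter
    with index m compares the entry of place [a], carried to place m by the earlier letters, with
    the entry of place m + 1. *)
Lemma inv_run_eq u a b : 0 < a <= b -> b <= n ->
  inv (u \oS stransp_run n a b) = inv u + (b - a) ->
  forall m, a <= m < b -> oneline u a < oneline u m.+1.
Proof.
move=> /andP[a0 ab]; elim: b ab => [|b IH]; first by lia.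
rewrite leq_eqVlt => /predU1P[<-|ab] bn; first by move=> _ m; lia.
rewrite stransp_runS // permcompA subSn // addnS => E m /andP[am mb].
have Hb : 0 < b < n by lia.
have := inv_stransp_oneline (u \oS stransp_run n a b) Hb.
have Ha : 0 < a <= b by rewrite a0.
have Hle := inv_run_leq u Ha (ltnW bn).
have b0 : 0 < b by lia.
rewrite !oneline_run // ?(ltnW bn) // eqxx gtn_eqF ?ltnSn //.
have -> : a <= b.+1 < b = false by lia.
case: ifP => [Hlt E'|_]; last by lia.
move: mb; rewrite ltnS leq_eqVlt => /predU1P[-> //|mb].
by apply: IH => //; [exact: ltnW | lia | rewrite am].
Qed.

Lemma cover_iff u i j : 0 < i -> i < j -> j <= n ->
  (len (u \oS transp n i j)).+1 = len u <->
  oneline u j < oneline u i /\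
  (forall p, i < p < j -> ~~ (oneline u j <= oneline u p <= oneline u i)).
Proof.
case: i j => // i [|j] // _; rewrite ltnS => ij jn; rewrite !lenE.
pose a := Ordinal (ltn_trans ij jn); pose b := Ordinal jn.
have ab : a < b by [].
rewrite (transpE a b) (onelineE u a) (onelineE u b) ltnS.
split=> [E|[uba H]].
  have uba : u b < u a.
    have := inv_tperm_lt u ab; rewrite -E.
    case: (ltngtP (u a) (u b)) => [_|//|/val_inj/perm_inj Eab _]; first by lia.
    by rewrite Eab ltnn in ab.
  split=> // -[//|p] /andP[ip pj]; have Hp : p < n by lia.
  have E' := inv_tperm ab uba.
  have : #|between u a b| == 0 by lia.
  rewrite cards_eq0 => /eqP /setP /(_ (Ordinal Hp)).
  rewrite !inE (onelineE u (Ordinal Hp)) !ltnS /=.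
  have : u (Ordinal Hp) != u a :> nat by rewrite val_eqE (inj_eq perm_inj) -val_eqE /=; lia.
  have : u (Ordinal Hp) != u b :> nat by rewrite val_eqE (inj_eq perm_inj) -val_eqE /=; lia.
  lia.
rewrite (inv_tperm ab uba); suff -> : between u a b = finset.set0 by rewrite cards0 addn0.
apply/setP => p; rewrite !inE; apply/negP => /andP[/andP[ap pb] /andP[h1 h2]].
have := H p.+1; rewrite (onelineE u p) !ltnS ap pb (ltnW h1) (ltnW h2).
by move/(_ isT).
Qed.

Lemma rank_tperm u (a b : 'I_n) p h : a < b -> u b < u a ->
  rank (word u) p h = rank (word (u \oS tperm a b)) p h +
    ((a < p <= b) && ((u b).+1 < h <= (u a).+1)).
Proof.
move=> ab uba; have [s [t [r [-> -> Hs Ht]]]] := word_tperm u ab.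
rewrite !rank_cat -addnA; congr addn.
case E: (p - size s) => [|e]; first by rewrite !rank0; lia.
rewrite !rank_cons !rank_cat.
case E2: (e - size t) => [|e']; rewrite ?rank0 ?rank_cons; lia.
Qed.

Section Decomposition.
Variables (k : nat) (v w : 'S_n).
Hypothesis kn : 2 <= k <= n - 2.
Hypothesis Ew : w = v \oS (stransp_run n k n \oS stransp_run n 1 k).
Hypothesis Elen : len w = len v + (n - 1).

Lemma oneline_rotated p : 0 < p -> p <= n -> oneline w p =
  oneline v (if p == k then 1 else if p == n then k
             else if p == k.-1 then k.+1 else p.+1).
Proof.
move=> p0 pn; rewrite Ew permcompA oneline_run //; [|lia|lia].
rewrite oneline_run //; [|lia|by do 2?case: ifP; lia].
congr oneline; do 8?case: ifP; lia.
Qed.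

(** The rise n - 1 is the sum of the largest possible rises n - k and k - 1 of the two runs, so both
    are attained. The last clause arises because the first run has brought v(k+1) to place k. *)
Lemma rotated_ineq :
  (forall m, k <= m < n -> oneline v k < oneline v m.+1) /\
  (forall m, 1 < m < k -> oneline v 1 < oneline v m) /\
  oneline v 1 < oneline v k.+1.
Proof.
have Hk1 : 0 < k <= n by lia.
have Hk2 : 0 < 1 <= k by lia.
have Hk3 : k <= n by lia.
have H1 := inv_run_leq v Hk1 (leqnn n).
have H2 := inv_run_leq (v \oS stransp_run n k n) Hk2 Hk3.
move: Elen; rewrite !lenE Ew permcompA => E.
have E1 : inv (v \oS stransp_run n k n) = inv v + (n - k) by lia.
have E2 : inv ((v \oS stransp_run n k n) \oS stransp_run n 1 k) =
  inv (v \oS stransp_run n k n) + (k - 1) by lia.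
split; first exact: inv_run_eq E1.
have H := inv_run_eq Hk2 Hk3 E2; split=> [m Hm|].
  have := H m.-1; rewrite !oneline_run ?leqnn //.
  have -> : (1 == n) = false by lia.
  have -> : (k <= 1 < n) = false by lia.
  have -> : m.-1.+1 = m by lia.
  have -> : (m == n) = false by lia.
  have -> : (k <= m < n) = false by lia.
  apply; lia.
have := H k.-1; rewrite !oneline_run ?leqnn //.
have -> : (1 == n) = false by lia.
have -> : (k <= 1 < n) = false by lia.
have -> : k.-1.+1 = k by lia.
have -> : (k == n) = false by lia.
have -> : (k <= k < n) by lia.
apply; lia.
Qed.

Lemma rotated_words : exists x L c a U, [/\ cross x L c a U,
  word v = lower x L c a U, word w = upper x L c a U,
  (size L).+2 = k & size U = n - k.+1].
Proof.
have [h1 [h2 h3]] := rotated_ineq.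
have : size (word v) = n by rewrite size_word.
have Hv p : oneline v p.+1 = nth 0 (word v) p := onelineE_nth v p.
have Uv := uniq_word v.
case E: (word v) => [|x s1] /= Hs; first by lia.
have HL : size (take (k - 2) s1) = k - 2 by rewrite size_takel; lia.
move: (take _ s1) (drop (k - 2) s1) HL (cat_take_drop (k - 2) s1) => L s2 HL Es1.
have : size s2 = n - k.-1 by move: Hs; rewrite -Es1 size_cat; lia.
case: s2 Es1 => [|c [|a U]] Es1 /= HU; [lia|lia|].
have {}E : word v = lower x L c a U by rewrite E /lower -Es1.
have Ex : oneline v 1 = x by rewrite Hv E.
have EL p : p < k - 2 -> oneline v p.+2 = nth 0 L p.
  by move=> Hp; rewrite Hv E /= nth_cat HL Hp.
have Ec : oneline v k = c.
  have -> : k = (k - 2).+2 by lia.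
  by rewrite Hv E /= nth_cat HL ltnn subnn.
have Ea : oneline v k.+1 = a.
  have -> : k = (k - 2).+2 by lia.
  by rewrite Hv E /= nth_cat HL ltnNge leqnSn /= subSn // subnn.
have EU p : oneline v (k + p).+2 = nth 0 U p.
  have -> : k + p = (k - 2 + p).+2 by lia.
  rewrite Hv E /= nth_cat HL ltnNge -addnS -addnS leq_addr /=.
  by rewrite addKn.
exists x, L, c, a, U; split=> //; [| | |lia|lia].
  split; first by rewrite -/(lower _ _ _ _ _) -E.
  - apply/(all_nthP 0) => p Hp; rewrite /= -EL; last by lia.
    by rewrite -Ex; apply: h2; lia.
  - by rewrite -Ex -Ea.
  - by rewrite -Ec -Ea; apply: h1; lia.
  by apply/(all_nthP 0) => p Hp; rewrite /= -EU -Ec; apply: h1; lia.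
- by rewrite /lower -Es1.
apply: (@eq_from_nth _ 0).
  by rewrite size_word -(perm_size (perm_lower_upper _ _ _ _ _)) size_lower; lia.
rewrite size_word => p Hp; rewrite -onelineE_nth oneline_rotated // /upper.
have [pL|Lp] := ltnP p (k - 2).
  have -> : (p.+1 == k) = false by lia.
  have -> : (p.+1 == n) = false by lia.
  have -> : (p.+1 == k.-1) = false by lia.
  by rewrite EL // nth_cat HL pL.
have {Lp} [q Eq] : exists q, p = k - 2 + q by exists (p - (k - 2)); lia.
subst p; rewrite nth_cat HL ltnNge leq_addr /= addKn.
case: q Hp => [|[|q]] Hp /=.
- have -> : ((k - 2 + 0).+1 == k) = false by lia.
  have -> : ((k - 2 + 0).+1 == n) = false by lia.
  by have -> : ((k - 2 + 0).+1 == k.-1) by lia.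
- by have -> : ((k - 2 + 1).+1 == k) by lia.
have -> : ((k - 2 + q.+2).+1 == k) = false by lia.
have -> : ((k - 2 + q.+2).+1 == k.-1) = false by lia.
rewrite nth_rcons; case: (ltngtP q (size U)) => Hq.
- have -> : ((k - 2 + q.+2).+1 == n) = false by lia.
  have -> : (k - 2 + q.+2).+2 = (k + q).+2 by lia.
  exact: EU.
- by lia.
by have -> : ((k - 2 + q.+2).+1 == n) by lia.
Qed.

End Decomposition.

End RotatedPair.

(** * Coatoms, and the pairs of type (3) *)

Section Coatoms.
Variables (n k : nat) (v w : 'S_n) (x c a : nat) (L U : seq nat).
Hypothesis HX : cross x L c a U.
Hypothesis Ev : word v = lower x L c a U.
Hypothesis Ew : word w = upper x L c a U.
Hypothesis Hk : (size L).+2 = k.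
Hypothesis HU : size U = n - k.+1.
Hypothesis kn : k < n.

Local Notation W := (oneline w).

Lemma oneline_left p : 0 < p < k.-1 -> W p = nth 0 L p.-1.
Proof.
case: p => // p /andP[_ Hp]; rewrite onelineE_nth Ew /upper nth_cat /=.
by have -> : p < size L by lia.
Qed.

Lemma oneline_peak : W k.-1 = a.
Proof. by rewrite -Hk onelineE_nth Ew nth_cat ltnn subnn. Qed.

Lemma oneline_bottom : W k = x.
Proof. by rewrite -Hk onelineE_nth Ew nth_cat ltnNge leqnSn /= subSn // subnn. Qed.

Lemma oneline_right p : W (k + p.+1) = nth 0 (rcons U c) p.
Proof.
have -> : k + p.+1 = (size L + p.+2).+1 by lia.
by rewrite onelineE_nth Ew nth_cat ltnNge leq_addr /= addKn.
Qed.

Lemma oneline_last : W n = c.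
Proof.
transitivity (W (k + (size U).+1)); first by congr (oneline w _); lia.
by rewrite oneline_right nth_rcons ltnn eqxx.
Qed.

Lemma oneline_inj p q : 0 < p <= n -> 0 < q <= n -> W p = W q -> p = q.
Proof.
case: p q => // p [|q] //= Hp Hq; rewrite !onelineE_nth => /eqP.
by rewrite nth_uniq ?size_word ?uniq_word // => /eqP ->.
Qed.

Lemma oneline_gt0 p : 0 < p <= n -> 0 < W p.
Proof. by case: p => // p /= Hp; rewrite (onelineE w (Ordinal Hp)). Qed.

Lemma bottom_lt p : 0 < p < k -> x < W p.
Proof.
move=> Hp; have [_ HL xa _ _] := HX.
have [->|pk] := eqVneq p k.-1; first by rewrite oneline_peak.
by rewrite oneline_left; [apply: (all_nthP 0 HL); lia | lia].
Qed.

Lemma last_lt p : k < p < n -> c < W p.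
Proof.
move=> Hp; have [_ _ _ _ HcU] := HX.
have -> : p = k + (p - k.+1).+1 by lia.
rewrite oneline_right nth_rcons; have -> : p - k.+1 < size U by lia.
by apply: (all_nthP 0 HcU); lia.
Qed.

Lemma last_leq p : k < p <= n -> c <= W p.
Proof.
move=> Hp; have [->|pn] := eqVneq p n; first by rewrite oneline_last.
by apply/ltnW/last_lt; lia.
Qed.

(* The prefixes of length p of the words of v and w differ by one element: the
   counts of their entries >= h differ exactly when wlow p < h <= whigh p. *)
Definition wlow p := if p < k then x else c.
Definition whigh p := if p == k then a else W p.

Lemma rank_upper p h : 0 < p < n ->
  rank (word w) p h = rank (word v) p h + (wlow p < h <= whigh p).
Proof.
case: p => // q /= qn; have [_ HL xa ca HcU] := HX.
have := @bottom_lt q.+1; have := @last_lt q.+1.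
rewrite /wlow /whigh Ev Ew /lower /upper rank_cons !rank_cat.
have [qL|Lq] := ltnP q (size L).
  have -> : q.+1 < k by lia.
  have -> : (q.+1 == k) = false by lia.
  have -> : q - size L = 0 by lia.
  have -> : q.+1 - size L = 0 by lia.
  rewrite !rank0 rankS qL oneline_left ?ltnS //=; last by lia.
  by move=> _ /(_ isT); lia.
have [e Eq] : exists e, q = size L + e by exists (q - size L); lia.
subst q; rewrite -addnS !addKn !(rank_size (s := L)) ?leq_addr //.
case: e qn Lq => [|[|e]] qn _; rewrite ?rank0 !rank_cons ?rank0.
- have -> : size L + 1 < k by lia.
  have -> : (size L + 1 == k) = false by lia.
  have -> : size L + 1 = k.-1 by lia.
  by rewrite oneline_peak; lia.
- have -> : size L + 2 < k = false by lia.
  have -> : size L + 2 == k by lia.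
  lia.
have -> : size L + e.+3 < k = false by lia.
have -> : (size L + e.+3 == k) = false by lia.
have He : e < size U by lia.
have -> : size L + e.+3 = k + e.+1 by lia.
rewrite rankS size_rcons ltnS (ltnW He) oneline_right.
have -> : rank (rcons U c) e h = rank U e h.
  by rewrite -cats1 rank_cat (eqnP (ltnW He)) rank0 addn0.
by move=> H _; have := H _; lia.
Qed.

Lemma dom_rotated : dom (word v) (word w).
Proof.
move=> p h; case: (posnP p) => [->|p0]; first by rewrite !rank0.
have [pn|np] := ltnP p n; first by rewrite (rank_upper h) ?p0 // leq_addr.
rewrite !rank_size ?size_word //.
by rewrite (seq.permP (perm_word2 v w)).
Qed.

(** The exchange lowers the ranks of [w] by one on a rectangle of cuts and thresholds, so this
    rectangle must lie inside the region where [w] exceeds [v] by one. *)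
Lemma dom_rotated_tperm i j : 0 < i -> i < j -> j <= n -> W j < W i ->
  dom (word v) (word (w \oS transp n i j)) <->
  forall p, i <= p < j -> wlow p <= W j /\ W i <= whigh p.
Proof.
case: i j => // i [|j] // _; rewrite ltnS => ij jn.
pose i' := Ordinal (ltn_trans ij jn); pose j' := Ordinal jn.
have ij' : i' < j' by [].
rewrite (transpE i' j') (onelineE w i') (onelineE w j') ltnS => wji.
have Hrank p h := @rank_tperm _ w i' j' p h ij' wji.
split=> [H p /andP[ip pj]|H p h].
  have pn : 0 < p < n by lia.
  (* The lowest and the highest threshold of the rectangle; letters of the word are one more than
     the 0-based values. *)
  have H1 := H p (w j').+2; have H2 := H p (w i').+1.
  have := Hrank p (w j').+2; have := Hrank p (w i').+1; rewrite !rank_upper //=.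
  rewrite ip (_ : p <= j); last by lia.
  by rewrite !ltnS leqnn wji /=; lia.
have := Hrank p h; case: (boolP (i' < p <= j')) => [Hp|_] /=; last first.
  by move=> E; have := dom_rotated p h; lia.
have /H : i.+1 <= p < j.+1 by move: Hp => /=; lia.
have pn : 0 < p < n by move: Hp => /=; lia.
rewrite rank_upper //; lia.
Qed.

Lemma bruhat_rotated : bruhat v w.
Proof. exact/bruhatP/dom_rotated. Qed.

Lemma coatom_dom i j : 0 < i -> i < j -> j <= n ->
  (len (w \oS transp n i j)).+1 = len w ->
  coatom v w (w \oS transp n i j) <->
  forall p, i <= p < j -> wlow p <= W j /\ W i <= whigh p.
Proof.
move=> i0 ij jn El; have [wji _] := (cover_iff w i0 ij jn).1 El.
rewrite -dom_rotated_tperm //; apply: coatomE => //; first exact: bruhat_rotated.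
case: i j i0 ij jn wji {El} => // i [|j] // _; rewrite ltnS => ij jn.
pose i' := Ordinal (ltn_trans ij jn); pose j' := Ordinal jn.
rewrite (transpE i' j') (onelineE w i') (onelineE w j') ltnS => wji.
rewrite -{2}[w](permcomp_tpermK w i' j'); apply: bruhat_tperm => //.
by rewrite !permcompE tpermL tpermR.
Qed.

Lemma one_at_bottom_or_last : 0 < n -> W k = 1 \/ W n = 1.
Proof.
move=> n0; have : 1 \in word w.
  by rewrite (perm_mem (perm_word w)) mem_iota leqnn add1n ltnS.
case/(nthP 0) => p; rewrite size_word => Hp; rewrite -onelineE_nth => E.
have [Hpk|Hpk|<-] := ltngtP p.+1 k; last by left.
  have := @bottom_lt p.+1; rewrite E Hpk => /(_ isT) x1.
  have := @oneline_gt0 k; rewrite oneline_bottom; lia.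
have [Hpn|Hpn|Epn] := ltngtP p.+1 n; [|lia|by right; rewrite Epn in E].
have := @last_lt p.+1; rewrite E Hpk Hpn => /(_ isT) c1.
have := @oneline_gt0 n; rewrite oneline_last; lia.
Qed.

(** The upper bound at p = k is [a] instead of [W k], hence the exception p = k in type (3). The
    lower bound is [x = W k] before k and the least value [c] from k on, so it matters only when i <
    k < j. In type (2), [W k] cannot be 1 because [W j] is smaller. *)
Lemma coatom_types i j : 0 < i -> i < j -> j <= n ->
  (len (w \oS transp n i j)).+1 = len w ->
  coatom v w (w \oS transp n i j) <->
  [\/ coatom_type1 k w i j, coatom_type2 k w i j | coatom_type3 k w i j].
Proof.
move=> i0 ij jn El; have [wji _] := (cover_iff w i0 ij jn).1 El.
have k0 : 0 < k by lia.
have n0 : 0 < n by lia.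
have Hne p q : 0 < p <= n -> 0 < q <= n -> p != q -> W p != W q.
  by move=> Hp Hq; apply: contra_neq; apply: oneline_inj.
rewrite coatom_dom //; split=> [H|[[Hij H]|[[Ei [kj _]] [H H1]]|[[_ [ik [kj _]]] [H H1]]]].
- have [jk|kj] := leqP j k; [|have [ki|ik|Eik] := ltngtP k i].
  + apply: Or31; split=> [|p Hp]; first by left.
    have [|_] := H p; first by lia.
    have := Hne i p; rewrite /whigh (_ : (p == k) = false); lia.
  + apply: Or31; split=> [|p Hp]; first by right.
    have [|_] := H p; first by lia.
    have := Hne i p; rewrite /whigh (_ : (p == k) = false); lia.
  + apply: Or33; split=> //; split=> [p Hp pk|].
      have [|_] := H p; first by lia.
      have := Hne i p; rewrite /whigh (_ : (p == k) = false); lia.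
    have [|+ _] := H i; first by lia.
    have := Hne k j; rewrite /wlow ik oneline_bottom; lia.
  apply: Or32; split=> //; split=> [p Hp|].
    have [|_] := H p; first by lia.
    have := Hne i p; rewrite /whigh (_ : (p == k) = false); lia.
  have [E|//] := one_at_bottom_or_last n0.
  by move: wji; rewrite -Eik E ltnS leqn0 -leqn0; have := @oneline_gt0 j; lia.
- move=> p Hp; have Hip : W i <= W p.
    have [->|ip] := eqVneq i p; first exact: leqnn.
    by apply/ltnW/H; lia.
  rewrite /wlow /whigh; case: Hij => [[_ [_ jk]]|[ki _]].
    have -> : p < k by lia.
    have -> : (p == k) = false by lia.
    split=> //; have [->|jk'] := eqVneq j k; first by rewrite oneline_bottom.
    by apply/ltnW/bottom_lt; lia.
  have -> : p < k = false by lia.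
  have -> : (p == k) = false by lia.
  by split=> //; apply: last_leq; lia.
- move=> p Hp; rewrite /wlow /whigh.
  have -> : p < k = false by lia.
  split; first by apply: last_leq; lia.
  case: (eqVneq p k) => [_|pk]; last by apply/ltnW/H; lia.
  by have [_ _ xa _ _] := HX; rewrite Ei oneline_bottom ltnW.
move=> p Hp; rewrite /wlow /whigh.
have Hip : p <> k -> W i <= W p.
  move=> pk; have [->|ip] := eqVneq i p; first exact: leqnn.
  by apply/ltnW/H => //; lia.
split.
  case: ifP => _; first by rewrite -oneline_bottom ltnW.
  by apply: last_leq; lia.
case: (eqVneq p k) => [_|/eqP //]; rewrite -oneline_peak.
have [->|ik'] := eqVneq i k.-1; first exact: leqnn.
by apply/ltnW/H; lia.
Qed.

Definition pair3 i j := [/\ 0 < i < k, k < j <= n,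
  forall p, i < p < j -> p <> k -> W i < W p, W k < W j & W j < W i].

Lemma pair3E i j :
  (len (w \oS transp n i j)).+1 = len w /\ coatom_type3 k w i j <-> pair3 i j.
Proof.
split=> [[El [[i0 [ik [kj jn]]] [H1 H2]]]|[/andP[i0 ik] /andP[kj jn] H1 H2 H3]].
  have [] := (cover_iff w i0 (ltn_trans ik kj) jn).1 El.
  by split=> //; apply/andP.
split; last by split.
apply/(cover_iff w i0 (ltn_trans ik kj) jn); split=> // p Hp.
have [->|/eqP pk] := eqVneq p k; first by lia.
by have := H1 p Hp pk; lia.
Qed.

Lemma last_filter (P : pred nat) (y : nat) (s : seq nat) :
  (last y (filter P s) = y /\ all (predC P) s) \/
  exists s1 s2, [/\ s = s1 ++ last y (filter P s) :: s2,
    P (last y (filter P s)) & all (predC P) s2].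
Proof.
elim/last_ind: s => [|s e IH]; first by left.
rewrite filter_rcons; case: ifP => Pe.
  by right; exists s, [::]; rewrite last_rcons cats1.
case: IH => [[-> H]|[s1 [s2 [E Hl H]]]].
  by left; rewrite all_rcons /= Pe.
right; exists s1, (rcons s2 e); split=> //; last by rewrite all_rcons /= Pe.
by rewrite {1}E rcons_cat.
Qed.

Lemma first_below y : c < y -> exists j, [/\ k < j <= n, W j < y &
  forall p, k < p < j -> y <= W p].
Proof.
move=> cy; pose f := find (ltn^~ y) (rcons U c).
have Hf : has (ltn^~ y) (rcons U c) by rewrite has_rcons /= cy.
have Hs := Hf; rewrite has_find size_rcons -/f in Hs.
exists (k + f.+1); split; first by lia.
  by rewrite oneline_right; apply: (nth_find 0 Hf).
move=> p Hp; have -> : p = k + (p - k.+1).+1 by lia.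
rewrite oneline_right leqNgt; have := @before_find _ 0 (ltn^~ y) (rcons U c) (p - k.+1).
by rewrite -/f => /= ->; lia.
Qed.

Lemma head_filter_first j : k < j <= n -> W j < a -> (forall p, k < p < j -> a <= W p) ->
  head c (filter (ltn^~ a) U) = W j.
Proof.
move=> Hj; have -> : j = k + (j - k.+1).+1 by lia.
have : j - k.+1 <= size U by lia.
move: (j - k.+1) => f Hf wja Hp.
have {Hp} Hp e : e < f -> a <= nth 0 (rcons U c) e.
  by move=> ef; rewrite -oneline_right; apply: Hp; lia.
rewrite oneline_right in wja *; clear -Hf wja Hp.
elim: U f Hf wja Hp => [|y s IH] [|f] //= Hf wja Hp; first by rewrite wja.
have /= := Hp 0 isT; rewrite leqNgt => /negbTE ->.
by apply: IH => // e ef; apply: (Hp e.+1).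
Qed.

Lemma peak_pair : exists j, [/\ k < j <= n, W j = head c (filter (ltn^~ a) U),
  forall p, k < p < j -> a < W p & W j < a].
Proof.
have [_ _ _ ca _] := HX; have [j [Hj wja Hp]] := first_below ca.
exists j; split=> //; first exact/esym/head_filter_first.
move=> p Hpj; rewrite ltn_neqAle Hp // andbT -oneline_peak.
by apply/eqP => /oneline_inj; lia.
Qed.

Lemma pair3_peak j : k < j <= n -> (forall p, k < p < j -> a < W p) ->
  x < W j -> W j < a -> pair3 k.-1 j.
Proof.
move=> Hj Hp xj ja; split=> //; rewrite ?oneline_peak ?oneline_bottom //; first by lia.
by move=> p Hpj pk; apply: Hp; lia.
Qed.

Lemma pair3_le_peak i j : pair3 i j -> W i <= a.
Proof.
case=> Hi Hj H _ _; have [->|ik] := eqVneq i k.-1; first by rewrite oneline_peak.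
by rewrite -oneline_peak; apply/ltnW/H; lia.
Qed.

(** As c = 1, only d < x can hold, d being the first letter of U c below [a]. A pair of type (3)
    must end at the place of d: going past it violates minimality, and the earlier letters exceed
    [a]. So a pair exists iff x < d. *)
Lemma no_pair3 : c = 1 ->
  split_cond x L c a U <-> ~ exists ij : nat * nat, pair3 ij.1 ij.2.
Proof.
move=> c1; have [j [Hj Ed Hp ja]] := peak_pair.
have -> : split_cond x L c a U = (W j < x).
  rewrite /split_cond -Ed; suff -> : (last x (filter (ltn^~ a) L) < c) = false by [].
  have [_ HxL _ _ _] := HX; rewrite c1.
  have [[-> _]|[s1 [s2 [E _ _]]]] := last_filter (ltn^~ a) x L.
    by have := @oneline_gt0 k; rewrite oneline_bottom; lia.
  have : last x (filter (ltn^~ a) L) \in L by rewrite {2}E mem_cat mem_head orbT.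
  by move/(allP HxL) => /=; lia.
split=> [jx [[i j'] /= Hij]|H].
  have Hia := pair3_le_peak Hij.
  have [Hi Hj' H xj' ji'] := Hij; rewrite oneline_bottom in xj'.
  have [jj'|j'j|E] := ltngtP j j'.
  - have := H j; lia.
  - have := Hp j'; lia.
  - by rewrite E in jx; lia.
rewrite ltnNge; apply/negP => xj; apply: H; exists (k.-1, j) => /=.
apply: pair3_peak => //; rewrite ltn_neqAle xj andbT -oneline_bottom.
by apply/eqP => /oneline_inj; lia.
Qed.

(** As x = 1, the peak always gives a pair, and [split_cond] reduces to b < c, with b the last
    letter of x L below [a]. A second pair exists iff c < b. *)
Lemma unique_pair3 : x = 1 ->
  split_cond x L c a U <-> exists! ij : nat * nat, pair3 ij.1 ij.2.
Proof.
move=> x1; have [_ HxL xa ca _] := HX.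
have [j [Hj Ed Hp ja]] := peak_pair.
have xj : x < W j.
  have h0 := @oneline_gt0 j; rewrite ltn_neqAle; apply/andP; split; last by lia.
  by rewrite -oneline_bottom; apply/eqP => /oneline_inj; lia.
have Hkj : pair3 k.-1 j by apply: pair3_peak.
have -> : split_cond x L c a U = (last x (filter (ltn^~ a) L) < c).
  by rewrite /split_cond -Ed (_ : W j < x = false) ?orbF //; lia.
set b := last _ _; have Hb := last_filter (ltn^~ a) x L; rewrite -/b in Hb.
split=> [bc|[ij0 [_ Huniq]]].
  exists (k.-1, j); split=> // -[i j'] /= Hij; have [Hi Hj' H xj' ji'] := Hij.
  have [Ei|ik] := eqVneq i k.-1.
    rewrite Ei oneline_peak in H ji' *; congr pair.
    have [jj'|j'j|//] := ltngtP j j'; [have := H j | have := Hp j']; lia.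
  have wia : W i < a by rewrite -oneline_peak; apply: H; lia.
  have wib : c < W i by apply: leq_ltn_trans ji'; apply: last_leq.
  have HiL : i.-1 < size L by lia.
  have EiL : W i = nth 0 L i.-1 by rewrite oneline_left //; lia.
  case: Hb => [[_ HLa]|[s1 [s2 [EL ba Hs2]]]].
    by have := all_nthP 0 HLa _ HiL; rewrite /= -EiL wia.
  have Eb : W (size s1).+1 = b.
    rewrite oneline_left /=; last by rewrite -Hk EL size_cat /=; lia.
    by rewrite EL nth_cat ltnn subnn.
  (* The value at [i] lies above [c] and below [a]. Before the place of [b] it would have to be
     below [b < c]; at that place it would be [b]; after it, all letters of [L] are at least [a]. *)
  have [is1|s1i|Ei] := ltngtP i (size s1).+1.
  - have hs : size s1 < size L by rewrite EL size_cat /= addnS ltnS leq_addr.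
    by have := H (size s1).+1; rewrite Eb is1; lia.
  - have Es2 : i.-1 = size s1 + (i.-1 - (size s1).+1).+1 by lia.
    have Hs : i.-1 - (size s1).+1 < size s2 by move: HiL; rewrite EL size_cat /=; lia.
    move: EiL; rewrite Es2 EL nth_cat ltnNge leq_addr /= addKn /= => EiL.
    by have := all_nthP 0 Hs2 _ Hs; rewrite /= -EiL wia.
  - by rewrite Ei Eb in wib; lia.
rewrite ltnNge; apply/negP => cb.
have c0 : 0 < c by rewrite -oneline_last; apply: oneline_gt0; lia.
have xc : x != c.
  by apply/eqP; rewrite -oneline_last -oneline_bottom => /oneline_inj; lia.
case: Hb => [[Eb _]|[s1 [s2 [EL ba Hs2]]]]; first by lia.
have Hs1 : size s1 < size L by rewrite EL size_cat /= addnS ltnS leq_addr.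
have Eb : W (size s1).+1 = b.
  by rewrite oneline_left /=; [rewrite EL nth_cat ltnn subnn | lia].
have cb' : c < b.
  rewrite ltn_neqAle cb andbT -Eb -oneline_last.
  by apply/eqP => /oneline_inj; lia.
(* The second pair joins the place of [b] to the first letter after place k that is below [b]; the
   final letter [c] guarantees one. *)
have [j' [Hj' j'b Hpj]] := first_below cb'.
have Hib : pair3 (size s1).+1 j'.
  split=> //; rewrite ?Eb ?oneline_bottom //; first by lia.
    move=> p Hpp pk; have [pk'|kp] := ltnP p k; last first.
      have bp : b <= W p by apply: Hpj; lia.
      by rewrite ltn_neqAle bp andbT -Eb; apply/eqP => /oneline_inj; lia.
    have [->|pk1] := eqVneq p k.-1; first by rewrite oneline_peak.
    rewrite oneline_left; last by lia.
    have -> : p.-1 = size s1 + (p.-1 - (size s1).+1).+1 by lia.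
    have Hs : p.-1 - (size s1).+1 < size s2.
      have : p.-1 < size L by lia.
      by rewrite EL size_cat /=; lia.
    rewrite EL nth_cat [_ + _ < _]ltnNge leq_addr /= addKn /=.
    by have := all_nthP 0 Hs2 _ Hs; rewrite /= -leqNgt; apply: leq_trans.
  have := last_leq Hj'; have := oneline_gt0; lia.
have := Huniq (k.-1, j) Hkj; rewrite (Huniq ((size s1).+1, j') Hib) => -[]; lia.
Qed.

Lemma comb_cubeP (R : realType) : comb_cube (bruhat_polytope R v w) <-> split_cond x L c a U.
Proof.
have n0 : 0 < n by lia.
have En : n.-1 = (size L + size U).+2.
  by have := perm_size (perm_word v); rewrite Ev size_lower size_iota => <-.
have := cross_dichotomy R HX; rewrite /dichotomy -Ev -Ew -En.
case: ifP => _ H; split=> //.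
  by move=> _; apply: cubical_comb_cube H => // z; apply: bruhat_itvE.
by move=> HC; case: (atleast_not_cube n0 (@bruhat_itvE _ v w) H HC).
Qed.

End Coatoms.

Theorem proposition8p8 (R : realType) (n k : nat) (v w : 'S_n) :
  4 <= n -> 2 <= k <= n - 2 ->
  w = v \oS (stransp_run n k n \oS stransp_run n 1 k) ->
  len w = len v + (n - 1) ->
  [/\
      oneline w k = 1 \/ oneline w n = 1,
      forall i j : nat, 1 <= i -> i < j -> j <= n ->
        (len (w \oS transp n i j)).+1 = len w <->
        oneline w j < oneline w i /\
        (forall p, i < p < j -> ~~ (oneline w j <= oneline w p <= oneline w i)),
      forall i j : nat, 1 <= i -> i < j -> j <= n ->
        (len (w \oS transp n i j)).+1 = len w ->
        coatom v w (w \oS transp n i j) <->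
        [\/ coatom_type1 k w i j, coatom_type2 k w i j
          | coatom_type3 k w i j],
      oneline w n = 1 ->
        comb_cube (bruhat_polytope R v w) <->
        ~ exists ij : nat * nat,
            (len (w \oS transp n ij.1 ij.2)).+1 = len w /\
            coatom_type3 k w ij.1 ij.2
    & oneline w k = 1 ->
        comb_cube (bruhat_polytope R v w) <->
        exists! ij : nat * nat,
            (len (w \oS transp n ij.1 ij.2)).+1 = len w /\
            coatom_type3 k w ij.1 ij.2].
Proof.
move=> n4 Hkn Ew Elen.
have [x [L [c [a [U [HX Ev Ew' Hk HU]]]]]] := rotated_words Hkn Ew Elen.
have kn : k < n by lia.
have pE (ij : nat * nat) : (len (w \oS transp n ij.1 ij.2)).+1 = len w /\
    coatom_type3 k w ij.1 ij.2 <-> pair3 k w ij.1 ij.2 by exact: (pair3E w Hk HU kn).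
split.
- by apply: (one_at_bottom_or_last HX Ew' Hk HU kn); lia.
- by move=> i j; apply: cover_iff.
- by move=> i j; apply: (coatom_types HX Ev Ew' Hk HU kn).
- rewrite (oneline_last Ew' Hk HU kn) => c1.
  rewrite (comb_cubeP HX Ev Ew' Hk HU kn) (no_pair3 HX Ew' Hk HU kn c1).
  by split=> H [ij /pE Hij]; apply: H; exists ij.
rewrite (oneline_bottom Ew' Hk) => x1.
rewrite (comb_cubeP HX Ev Ew' Hk HU kn) (unique_pair3 HX Ew' Hk HU kn x1).
by split=> -[ij [/pE Hij Hu]]; exists ij; split=> // ij' /pE /Hu.
Qed.
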